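(* Let $\alpha=(\alpha_n)_{n\in\mathbb{N}}$ satisfy $\alpha_n\uparrow\infty$ and $S_1(\alpha)\neq\emptyset$. Then $$D(1)\cup\{1\}=\bigcup_{k\in\mathbb{N}}D(s_0(k))\cup\Sigma\subseteq\sigma(\mathsf{C};\Lambda_0(\alpha))$$ and also $$\sigma(\mathsf{C};\Lambda_0(\alpha))\subseteq\bigcup_{k\in\mathbb{N}}\sigma(\mathsf{C};c_0(w_k))\subseteq\overline{D(1)}.$$ In particular, $$\sigma^*(\mathsf{C};\Lambda_0(\alpha))=\overline{\sigma(\mathsf{C};\Lambda_0(\alpha))}=\overline{D(1)}.$$
   Context: Notation: $\mathbb{N}=\{1,2,3,\ldots\}$. The notation $\alpha_n\uparrow\infty$ means that $\alpha=(\alpha_n)_{n\in\mathbb{N}}\subseteq(1,\infty)$ satisfies $\alpha_n<\alpha_{n+1}$ for all $n\in\mathbb{N}$ and $\lim_{n\to\infty}\alpha_n=\infty$. For $k,n\in\mathbb{N}$ put $w_k(n):=e^{-\alpha_n/k}$, and let $c_0(w_k):=\{x\in\mathbb{C}^{\mathbb{N}}\colon\lim_{n\to\infty}w_k(n)|x_n|=0\}$, a Banach space for the norm $p_k(x):=\sup_{n\in\mathbb{N}}w_k(n)|x_n|$. The power series space of finite type is $\Lambda_0(\alpha):=\bigcap_{k\in\mathbb{N}}c_0(w_k)$, a Fréchet space for the topology generated by the increasing sequence of norms $p_k$, $k\in\mathbb{N}$. The discrete Cesàro operator is $\mathsf{C}x:=\left(x_1,\frac{x_1+x_2}{2},\ldots,\frac{x_1+\cdots+x_n}{n},\ldots\right)$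 for $x\in\mathbb{C}^{\mathbb{N}}$; it maps $\Lambda_0(\alpha)$, and each $c_0(w_k)$, continuously into itself. For $k\in\mathbb{N}$ let $S_k(\alpha):=\left\{s\in\mathbb{R}\colon\sum_{n=1}^\infty\frac{e^{\alpha_n/k}}{n^s}<\infty\right\}$; whenever $S_k(\alpha)\neq\emptyset$ put $s_0(k):=\inf S_k(\alpha)$ (one has $S_k(\alpha)\subseteq S_{k+1}(\alpha)$ for all $k$, and $s_0(k)\geq1$). For $r\geq1$ let $D(r):=\left\{\lambda\in\mathbb{C}\colon\left|\lambda-\frac{1}{2r}\right|<\frac{1}{2r}\right\}$. Moreover, $\Sigma:=\{\frac1m\colon m\in\mathbb{N}\}$. For a locally convex Hausdorff space $X$, $\mathcal{L}(X)$ is the space of continuous linear operators from $X$ into itself. For $T\in\mathcal{L}(X)$: the resolvent set $\rho(T;X)$ consists of all $\lambda\in\mathbb{C}$ such that $R(\lambda,T):=(\lambda I-T)^{-1}$ exists in $\mathcal{L}(X)$; $\sigma(T;X):=\mathbb{C}\setminus\rho(T;X)$; $\rho^*(T;X)$ consists of all $\lambda\in\mathbb{C}$ for which there exists $\delta>0$ such that $B(\lambda,\delta):=\{z\in\mathbb{C}\colon|z-\lambda|<\delta\}\subseteq\rho(T;X)$ and $\{R(\mu,T)\colon\mu\in B(\lambda,\delta)\}$ is equicontinuous in $\mathcal{L}(X)$; and $\sigma^*(T;X):=\mathbb{C}\setminus\rho^*(T;X)$. *)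

(* Defs.v *)
From HB Require Import structures.
From mathcomp Require Import all_boot all_order all_algebra.
From mathcomp Require Import complex.
From mathcomp Require Import all_classical all_reals all_analysis.

Set Implicit Arguments.
Unset Strict Implicit.
Unset Printing Implicit Defensive.

Import Order.TTheory GRing.Theory Num.Theory.
Import numFieldNormedType.Exports.
Import ComplexField.Normc.

Local Open Scope classical_set_scope.
Local Open Scope ring_scope.
Local Open Scope complex_scope.

Section spectra.
Context (R : realType) (X : tvsType R[i]).

Definition continuous_linear : set (X -> X) :=
  [set T | linear T /\ continuous T].

Definition is_resolvent (T : X -> X) (l : R[i]) (S : X -> X) : Prop :=
  [/\ continuous_linear S,
      forall x, S (l *: x - T x) = x &
      forall x, l *: S x - T (S x) = x].

Definition resolvent_set (T : X -> X) : set R[i]^o :=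
  [set l | exists S, is_resolvent T l S].

Definition spectrum (T : X -> X) : set R[i]^o := ~` resolvent_set T.

(* A default value is returned outside of the resolvent set. *)
Definition resolvent (T : X -> X) (l : R[i]) : X -> X :=
  xget (fun=> 0) [set S | is_resolvent T l S].

(* [equicontinuous] requires a pointed codomain. *)
Definition tvs_puniform : puniformType := 
  HB.pack X (@isPointed.Build X 0).

Definition resolvent_set_star (T : X -> X) : set R[i]^o :=
  [set l | exists d : R, [/\ 0 < d,
     ball (l : R[i]^o) d%:C `<=` resolvent_set T &
     @equicontinuous X tvs_puniform _ (ball (l : R[i]^o) d%:C) (resolvent T)]].

Definition spectrum_star (T : X -> X) : set R[i]^o :=
  ~` resolvent_set_star T.

End spectra.

Section seminorms.
Context (R : realType) (I : eqType) (E : lmodType R[i]) (p : I -> E -> R).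

Definition seminorm (q : E -> R) : Prop :=
  (forall x y, q (x + y) <= q x + q y) /\
  (forall a x, q (a *: x) = normc a * q x).

(* Finitely many seminorms at a time, so that the family need not be directed. *)
Definition seminorm_entourage : set_system (E * E) :=
  [set A | exists (s : seq I) (e : R), 0 < e /\
    [set xy | forall i, i \in s -> p i (xy.1 - xy.2) < e] `<=` A].

Hypothesis p_semi : forall i, seminorm (p i).

Lemma seminorm0 i : p i 0 = 0.
Proof.
by case: (p_semi i) => _ /(_ 0 0); rewrite scale0r normc0 mul0r.
Qed.

Lemma seminormN i x : p i (- x) = p i x.
Proof.
by case: (p_semi i) => _ /(_ (-1) x); rewrite scaleN1r normcN normc1 mul1r.
Qed.

Lemma seminorm_ge0 i x : 0 <= p i x.
Proof.
have [pD _] := p_semi i.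
have := pD x (- x); rewrite subrr seminorm0 seminormN -mulr2n.
by rewrite pmulrn_lge0.
Qed.

Lemma seminorm_dist i x y z : p i (x - z) <= p i (x - y) + p i (y - z).
Proof.
have [pD _] := p_semi i.
by rewrite (le_trans _ (pD _ _))// addrA subrK.
Qed.

Lemma seminorm_entourage_filter : Filter seminorm_entourage.
Proof.
split.
- by exists [::], 1; split.
- move=> A B [s [e [e0 sA]]] [t [f [f0 tB]]].
  exists (s ++ t), (Num.min e f); split; first by rewrite lt_min e0.
  move=> xy /= h; split; [apply: sA|apply: tB] => i ii.
  + by have := h i; rewrite mem_cat ii => /(_ isT); rewrite lt_min => /andP[].
  + have := h i; rewrite mem_cat ii orbT => /(_ isT).
    by rewrite lt_min => /andP[].
- move=> A B AB [s [e [e0 sA]]]; exists s, e; split => //.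
  exact: subset_trans AB.
Qed.

Lemma seminorm_entourage_diagonal A : seminorm_entourage A -> diagonal `<=` A.
Proof.
move=> [s [e [e0 sA]]] [x y] xy.
by apply: sA => i _ /=; rewrite (xy : x = y) subrr seminorm0.
Qed.

Lemma seminorm_entourage_inv A :
  seminorm_entourage A -> seminorm_entourage A^-1%relation.
Proof.
move=> [s [e [e0 sA]]]; exists s, e; split => // -[x y] /= h.
by apply: sA => i /h /=; rewrite -seminormN opprB.
Qed.

Lemma seminorm_entourage_split A : seminorm_entourage A ->
  exists2 B, seminorm_entourage B & (B \; B)%relation `<=` A.
Proof.
move=> [s [e [e0 sA]]].
exists [set xy | forall i, i \in s -> p i (xy.1 - xy.2) < e / 2].
  by exists s, (e / 2); split; first exact: divr_gt0.
move=> [x z] /= [y /= xy yz]; apply: sA => i si /=.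
rewrite (le_lt_trans (seminorm_dist i x y z))// [e]splitr ltrD//.
  exact: xy.
exact: yz.
Qed.

End seminorms.

Section seminorms_tvs.
Context (R : realType) (I : eqType) (E : PreUniformLmodule.type R[i])
  (p : I -> E -> R).
Hypothesis p_semi : forall i, seminorm (p i).
Hypothesis entE : entourage = seminorm_entourage p.

Lemma seminorm_nbhsP (x : E) (U : set E) : nbhs x U <->
  exists (s : seq I) (e : R), 0 < e /\
    [set y | forall i, i \in s -> p i (x - y) < e] `<=` U.
Proof.
rewrite -nbhs_entourageE; split.
- move=> [A]; rewrite entE => -[s [e [e0 sA]]] AU; exists s, e; split => //.
  move=> y h; apply: AU; rewrite /xsection/= inE; exact: sA.
- move=> [s [e [e0 sU]]].
  exists [set xy | forall i, i \in s -> p i (xy.1 - xy.2) < e].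
    by rewrite entE; exists s, e; split.
  by move=> y; rewrite /xsection/= inE => /sU.
Qed.

Lemma near_seminorm (x : E) (s : seq I) (e : R) : 0 < e ->
  \forall y \near x, forall i, i \in s -> p i (x - y) < e.
Proof. by move=> e0; apply/seminorm_nbhsP; exists s, e; split => // y hy. Qed.

Lemma seminorm_add_continuous : continuous (fun x : E * E => x.1 + x.2).
Proof.
move=> [x y] U /seminorm_nbhsP[s [e [e0 sU]]].
have e20 : 0 < e / 2 by rewrite divr_gt0.
exists ([set z | forall i, i \in s -> p i (x - z) < e / 2],
        [set z | forall i, i \in s -> p i (y - z) < e / 2]).
  by split; exact: near_seminorm.
move=> [a b] /= [ha hb]; apply: sU => i si.
have [pD _] := p_semi i.
rewrite opprD addrACA (le_lt_trans (pD _ _))// [e]splitr ltrD//.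
  exact: ha.
exact: hb.
Qed.

Lemma seminorm_scale_continuous :
  continuous (fun z : R[i]^o * E => z.1 *: z.2).
Proof.
move=> [a x] U /seminorm_nbhsP[s [e [e0 sU]]].
pose M := 1 + normc a + \sum_(i <- s) p i x.
have normc_ge0 (z : R[i]) : 0 <= normc z by case: z => u v; exact: sqrtr_ge0.
have sum_ge0 : 0 <= \sum_(i <- s) p i x.
  by apply: sumr_ge0 => i _; exact: seminorm_ge0.
have pM i : i \in s -> p i x <= M.
  move=> si; rewrite /M.
  have : p i x <= \sum_(j <- s) p j x.
    rewrite (big_rem i)//= lerDl; apply: sumr_ge0 => j _; exact: seminorm_ge0.
  move=> /le_trans; apply; rewrite lerDr addr_ge0//.
have aM : normc a + 1 <= M by rewrite /M [1 + _]addrC lerDl.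
have M0 : 0 < M by apply: lt_le_trans aM; rewrite ltr_wpDl.
pose d := Num.min 1 (e / (2 * M)).
have d0 : 0 < d by rewrite lt_min ltr01 divr_gt0// mulr_gt0.
exists (ball (a : R[i]^o) d%:C,
        [set z | forall i, i \in s -> p i (x - z) < d]).
  split; last exact: near_seminorm.
  by apply: nbhsx_ballx; rewrite ltcR.
move=> [b y] /= [hb hy]; apply: sU => i si.
have [pD pZ] := p_semi i.
have {}hb : normc (a - b) < d.
  by move: hb; rewrite -ball_normE /= /ball_/= ltcR.
have -> : a *: x - b *: y = (a - b) *: x + b *: (x - y).
  by rewrite scalerBl scalerBr addrA subrK.
rewrite (le_lt_trans (pD _ _))// !pZ.
have bM : normc b <= M.
  apply: le_trans aM.
  have -> : b = a + (b - a) by rewrite addrC subrK.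
  rewrite (le_trans (le_normcD _ _))// lerD2l.
  rewrite -normcN opprB (le_trans (ltW hb))// ge_min lexx//.
have dM : d * M <= e / 2.
  rewrite -ler_pdivlMr// (le_trans (_ : _ <= e / (2 * M)))//.
    by rewrite ge_min lexx orbT.
  by rewrite invfM mulrA.
rewrite [e]splitr ler_ltD//.
  apply: le_trans dM; apply: ler_pM => //; last exact: pM.
    exact: seminorm_ge0.
  exact: ltW.
apply: le_lt_trans (_ : M * p i (x - y) < _).
  by rewrite ler_wpM2r// seminorm_ge0.
apply: lt_le_trans dM.
by rewrite [ltRHS]mulrC ltr_pM2l//; exact: hy.
Qed.

Lemma seminorm_ball_open (x : E) (s : seq I) (e : R) :
  open [set y | forall i, i \in s -> p i (x - y) < e].
Proof.
rewrite openE => y hy; apply/seminorm_nbhsP.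
have [d [d0 hd]] : exists d : R, 0 < d /\
    forall i, i \in s -> p i (x - y) + d <= e.
  elim: s hy => [|j s IH] hy; first by exists 1.
  have [|d [d0 hd]] := IH.
    by move=> i si; apply: hy; rewrite in_cons si orbT.
  have := hy j; rewrite in_cons eqxx => /(_ isT) hj.
  exists (Num.min d (e - p j (x - y))); split.
    by rewrite lt_min d0 subr_gt0.
  move=> i; rewrite in_cons => /orP[/eqP->|si].
    by rewrite -lerBrDl ge_min lexx orbT.
  by rewrite (le_trans _ (hd _ si))// lerD2l ge_min lexx.
exists s, d; split => // z hz i si.
rewrite (le_lt_trans (seminorm_dist p_semi i x y z))//.
by rewrite (lt_le_trans _ (hd i si))// ltrD2l; exact: hz.
Qed.

Lemma seminorm_ball_convex (x : E) (s : seq I) (e : R) :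
  convex_set [set y | forall i, i \in s -> p i (x - y) < e].
Proof.
apply/convex_setW => y z; rewrite !inE /= => hy hz l l0 l1.
rewrite inE/= => i si.
have [pD pZ] := p_semi i.
rewrite [X in p i X](_ : _ = l%:num *: (x - y) + (1 - l%:num) *: (x - z)).
  rewrite (le_lt_trans (pD _ _))// !pZ.
  have le01 (t : R[i]) : 0 < t -> 0 < normc t /\ (normc t)%:C = t.
    move=> t0; have : `|t| = t by rewrite gtr0_norm.
    by move=> tE; split => //; rewrite -ltcR; move: t0; rewrite -{1}tE.
  have [nl0 nl] := le01 _ l0.
  have [nm0 nm] : 0 < normc (1 - l%:num) /\ (normc (1 - l%:num))%:C = (1 - l%:num).
    by apply: le01; rewrite subr_gt0.
  have lm : normc l%:num + normc (1 - l%:num) = 1.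
    apply/eqP; rewrite -(inj_eq (@complexI R)) rmorphD/= nl nm.
    by rewrite addrC subrK.
  rewrite -[e]mul1r -lm mulrDl ltrD// ltr_pM2l//.
    exact: hy.
  exact: hz.
rewrite !scalerBr addrACA -scalerDl [l%:num + _]addrC subrK scale1r.
by rewrite -opprD.
Qed.

Lemma seminorm_locally_convex :
  exists2 B : set_system E, (forall b, b \in B -> convex_set b) & basis B.
Proof.
exists [set b | open b /\ convex_set b].
  by move=> b; rewrite inE => -[].
split; first by move=> b [].
move=> x U /seminorm_nbhsP[s [e [e0 sU]]].
exists [set y | forall i, i \in s -> p i (x - y) < e] => //=; split.
  by split; [exact: seminorm_ball_open|exact: seminorm_ball_convex].
by move=> i _; rewrite subrr seminorm0.
Qed.

Lemma seminorm_linear_continuous (T : E -> E) : linear T ->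
  (forall i, exists j : I, forall x, p i (T x) <= p j x) -> continuous T.
Proof.
move=> linT hT x U /seminorm_nbhsP[s [e [e0 sU]]].
have [t ht] : exists t : seq I, forall i, i \in s ->
    exists2 j, j \in t & forall x, p i (T x) <= p j x.
  elim: s {sU} => [|i s [t ht]]; first by exists [::].
  have [j hj] := hT i; exists (j :: t) => k.
  rewrite in_cons => /orP[/eqP->|/ht[l lt hl]].
    by exists j => //; rewrite mem_head.
  by exists l => //; rewrite in_cons lt orbT.
apply/seminorm_nbhsP; exists t, e; split => // y hy; apply: sU => i /ht[j jt hj].
have -> : T x - T y = T (x - y).
  by rewrite addrC -scaleN1r -linT scaleN1r addrC.
by rewrite (le_lt_trans (hj _))//; exact: hy.
Qed.

End seminorms_tvs.

(* Sequences indexed by $\{1, 2, \ldots\}$ are represented by functions on [nat]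
   shifted by one: [x n] is $x_{n+1}$. The index [k] of the weights and norms
   is not shifted; it ranges over the positive integers. *)
Section sequence_spaces.
Context (R : realType).
Implicit Types (alpha w : nat -> R) (x y : nat -> R[i]).

Definition increasing_to_infty alpha : Prop :=
  [/\ forall n, 1 < alpha n,
      forall n, alpha n < alpha n.+1 &
      alpha n @[n --> \oo] --> +oo].

(* Only used for [k > 0]. *)
Definition weight alpha (k : nat) : nat -> R :=
  fun n => expR (- alpha n / k%:R).

Definition c0 w : {pred nat -> R[i]} :=
  mem [set x | w n * normc (x n) @[n --> \oo] --> (0 : R)].

Definition sup_norm w x : R := sup [set w n * normc (x n) | n in [set: nat]].

Definition Lambda0 alpha : {pred nat -> R[i]} :=
  mem [set x | forall k, (0 < k)%N -> x \in c0 (weight alpha k)].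

Lemma normc_ge0 (z : R[i]) : 0 <= normc z.
Proof. by case: z => a b; exact: sqrtr_ge0. Qed.

Lemma weight_gt0 alpha k n : 0 < weight alpha k n.
Proof. exact: expR_gt0. Qed.

Lemma c0P w x : reflect (w n * normc (x n) @[n --> \oo] --> (0 : R)) (x \in c0 w).
Proof. by rewrite unfold_in/=; apply: (iffP (asboolP _)). Qed.

Lemma Lambda0P alpha x :
  reflect (forall k, (0 < k)%N -> x \in c0 (weight alpha k)) (x \in Lambda0 alpha).
Proof. by rewrite unfold_in/=; apply: (iffP (asboolP _)). Qed.

Lemma c0_submod w : submod_closed (c0 w).
Proof.
split.
  apply/c0P; rewrite (_ : (fun n => _) = fun=> (0 : R)); first exact: cvg_cst.
  by apply/funext => n; rewrite (_ : normc _ = 0) ?mulr0//; exact: normc0.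
move=> a x y /c0P x0 /c0P y0; apply/c0P/norm_cvg0P.
apply: (@squeeze_cvgr _ _ _ _ (fun=> 0)
  (fun n => normc a * `|w n * normc (x n)| + `|w n * normc (y n)|)).
- apply: nearW => n; rewrite normr_ge0/= !normrM !(ger0_norm (normc_ge0 _)).
  rewrite mulrCA -mulrDr ler_wpM2l// (le_trans (le_normcD _ _))//.
  by rewrite lerD2r normcM.
- exact: cvg_cst.
- rewrite -[X in _ --> X](addr0 0) -[X in _ --> X + _](mulr0 (normc a)).
  apply: cvgD; last exact/norm_cvg0P.
  by apply: cvgM; [exact: cvg_cst|exact/norm_cvg0P].
Qed.

HB.instance Definition _ w := GRing.isSubmodClosed.Build R[i] (nat -> R[i])
  (c0 w) (GRing.submod_closed_semi (c0_submod w)).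

Lemma Lambda0_submod alpha : submod_closed (Lambda0 alpha).
Proof.
split; first by apply/Lambda0P => k _; exact: rpred0.
move=> a x y /Lambda0P xL /Lambda0P yL; apply/Lambda0P => k k0.
by rewrite rpredD ?rpredZ ?xL ?yL.
Qed.

HB.instance Definition _ alpha := GRing.isSubmodClosed.Build R[i] (nat -> R[i])
  (Lambda0 alpha) (GRing.submod_closed_semi (Lambda0_submod alpha)).

Record c0_space alpha (k : nat) := C0Space {
  c0_val : nat -> R[i] ;
  c0_valP : c0_val \in c0 (weight alpha k) }.

HB.instance Definition _ alpha k := [isSub for @c0_val alpha k].
HB.instance Definition _ alpha k := [Choice of c0_space alpha k by <:].
HB.instance Definition _ alpha k :=
  [SubChoice_isSubLmodule of c0_space alpha k by <:].

Record Lambda0_space alpha := Lambda0Space {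
  Lambda0_val : nat -> R[i] ;
  Lambda0_valP : Lambda0_val \in Lambda0 alpha }.

HB.instance Definition _ alpha := [isSub for @Lambda0_val alpha].
HB.instance Definition _ alpha := [Choice of Lambda0_space alpha by <:].
HB.instance Definition _ alpha :=
  [SubChoice_isSubLmodule of Lambda0_space alpha by <:].

Lemma sup_norm_le w x (M : R) :
  (forall n, w n * normc (x n) <= M) -> sup_norm w x <= M.
Proof.
by move=> h; apply: ge_sup; [exists (w 0 * normc (x 0%N)), 0%N|move=> _ [n _ <-]].
Qed.

Lemma sup_norm_ub w x n : x \in c0 w -> w n * normc (x n) <= sup_norm w x.
Proof.
move=> /c0P x0; apply: ub_le_sup; last by exists n.
have /cvg_seq_bounded[M [_ /(_ (M + 1))]] : cvgn (fun n => w n * normc (x n)).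
  by apply/cvg_ex; exists 0.
rewrite ltrDl ltr01 => /(_ isT) hM.
by exists (M + 1) => _ [m _ <-]; rewrite (le_trans (ler_norm _))// hM.
Qed.

Lemma c0_norm_seminorm alpha k :
  seminorm (fun x : c0_space alpha k => sup_norm (weight alpha k) (\val x)).
Proof.
have w0 n : 0 <= weight alpha k n by rewrite ltW// weight_gt0.
have le_scale a (x : c0_space alpha k) :
    sup_norm (weight alpha k) (\val (a *: x)) <=
    normc a * sup_norm (weight alpha k) (\val x).
  apply: sup_norm_le => n.
  rewrite (_ : normc _ = normc a * normc (\val x n)); last by rewrite -normcM.
  by rewrite mulrCA ler_wpM2l ?normc_ge0// sup_norm_ub// c0_valP.
split.
- move=> x y; apply: sup_norm_le => n.
  apply: le_trans (lerD (sup_norm_ub n (c0_valP x)) (sup_norm_ub n (c0_valP y))).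
  by rewrite -mulrDr ler_wpM2l//; exact: le_normcD.
- move=> a x; apply/eqP; rewrite eq_le; apply/andP; split; first exact: le_scale.
  have [->|a0] := eqVneq a 0.
    rewrite normc0 mul0r; apply: (le_trans _ (sup_norm_ub 0 (c0_valP (0 *: x)))).
    by rewrite mulr_ge0 ?normc_ge0.
  have na0 : 0 < normc a.
    rewrite lt_neqAle normc_ge0 andbT eq_sym; apply: contra a0 => /eqP.
    by move=> /eq0_normc ->.
  rewrite mulrC -ler_pdivlMr// mulrC -normcV.
  by have := le_scale a^-1 (a *: x); rewrite scalerA mulVf// scale1r.
Qed.

Definition Lambda0_c0 alpha (k : nat) (k0 : (0 < k)%N)
    (x : Lambda0_space alpha) : c0_space alpha k :=
  C0Space (elimT (Lambda0P _ _) (Lambda0_valP x) k k0).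

Lemma Lambda0_norm_seminorm alpha (k : nat) : (0 < k)%N ->
  seminorm (fun x : Lambda0_space alpha => sup_norm (weight alpha k) (\val x)).
Proof.
move=> k0; have [pD pZ] := c0_norm_seminorm alpha k; split.
- by move=> x y; have := pD (Lambda0_c0 k0 x) (Lambda0_c0 k0 y).
- by move=> a x; have := pZ a (Lambda0_c0 k0 x).
Qed.

Definition c0_norms alpha k (_ : unit) (x : c0_space alpha k) : R :=
  sup_norm (weight alpha k) (\val x).

(* The family starts at 0: its member [i] is the norm $p_{i+1}$. *)
Definition Lambda0_norms alpha (i : nat) (x : Lambda0_space alpha) : R :=
  sup_norm (weight alpha i.+1) (\val x).

Let c0_semi alpha k i := c0_norm_seminorm alpha k :
  seminorm (c0_norms (k := k) i).
Let Lambda0_semi alpha i := Lambda0_norm_seminorm alpha (ltn0Sn i) :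
  seminorm (Lambda0_norms (alpha := alpha) i).

HB.instance Definition _ alpha k := isUniform.Build (c0_space alpha k)
  (seminorm_entourage_filter (c0_norms (k := k)))
  (seminorm_entourage_diagonal (@c0_semi alpha k))
  (seminorm_entourage_inv (@c0_semi alpha k))
  (seminorm_entourage_split (@c0_semi alpha k)).

HB.instance Definition _ alpha := isUniform.Build (Lambda0_space alpha)
  (seminorm_entourage_filter (Lambda0_norms (alpha := alpha)))
  (seminorm_entourage_diagonal (@Lambda0_semi alpha))
  (seminorm_entourage_inv (@Lambda0_semi alpha))
  (seminorm_entourage_split (@Lambda0_semi alpha)).

Lemma c0_entourageE alpha k :
  entourage = seminorm_entourage (c0_norms (k := k)) :> set_system
    (c0_space alpha k * c0_space alpha k).
Proof. by []. Qed.

Lemma Lambda0_entourageE alpha :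
  entourage = seminorm_entourage (Lambda0_norms (alpha := alpha)).
Proof. by []. Qed.

HB.instance Definition _ alpha k :=
  PreTopologicalNmodule_isTopologicalNmodule.Build (c0_space alpha k)
    (seminorm_add_continuous (@c0_semi alpha k) (c0_entourageE alpha k)).
HB.instance Definition _ alpha k :=
  TopologicalNmodule_isTopologicalLmodule.Build R[i] (c0_space alpha k)
    (seminorm_scale_continuous (@c0_semi alpha k) (c0_entourageE alpha k)).
HB.instance Definition _ alpha k :=
  Uniform_isTvs.Build R[i] (c0_space alpha k)
    (seminorm_locally_convex (@c0_semi alpha k) (c0_entourageE alpha k)).

HB.instance Definition _ alpha :=
  PreTopologicalNmodule_isTopologicalNmodule.Build (Lambda0_space alpha)
    (seminorm_add_continuous (@Lambda0_semi alpha) (Lambda0_entourageE alpha)).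
HB.instance Definition _ alpha :=
  TopologicalNmodule_isTopologicalLmodule.Build R[i] (Lambda0_space alpha)
    (seminorm_scale_continuous (@Lambda0_semi alpha) (Lambda0_entourageE alpha)).
HB.instance Definition _ alpha :=
  Uniform_isTvs.Build R[i] (Lambda0_space alpha)
    (seminorm_locally_convex (@Lambda0_semi alpha) (Lambda0_entourageE alpha)).

End sequence_spaces.

Section cesaro_operator.
Context (R : realType).
Implicit Types (alpha w : nat -> R) (x : nat -> R[i]).

Lemma weight_nonincreasing alpha k : increasing_to_infty alpha ->
  forall m n, (m <= n)%N -> weight alpha k n <= weight alpha k m.
Proof.
move=> [_ inc _] m n mn; rewrite ler_expR ler_wpM2r ?invr_ge0// lerN2.
by move: mn; apply: (homo_leq (r := <=%R)) => [//|? ? ? /le_trans|i]; [exact|exact: ltW].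
Qed.

Lemma normc_sum (F : nat -> R[i]) n :
  normc (\sum_(i < n) F i) <= \sum_(i < n) normc (F i).
Proof.
elim: n => [|n IH]; first by rewrite !big_ord0 normc0.
by rewrite !big_ord_recr/= (le_trans (le_normcD _ _))// lerD2r.
Qed.

Lemma normc_nat n : normc (n%:R : R[i]) = n%:R.
Proof. by rewrite -[n%:R]/(1 *+ n) normcMn normc1. Qed.

Lemma weight_arithmetic_mean alpha k x n : increasing_to_infty alpha ->
  weight alpha k n * normc (arithmetic_mean x n) <=
  arithmetic_mean (fun i => weight alpha k i * normc (x i)) n.
Proof.
move=> ha; rewrite /arithmetic_mean/= !seriesEord/= normcM normcV normc_nat.
rewrite mulrCA ler_wpM2l// (le_trans (ler_wpM2l _ (normc_sum _ _)))//.
  by rewrite ltW// weight_gt0.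
rewrite mulr_sumr; apply: ler_sum => i _.
by rewrite ler_wpM2r ?normc_ge0// weight_nonincreasing// -ltnS.
Qed.

Lemma arithmetic_mean_c0 alpha k x : increasing_to_infty alpha ->
  x \in c0 (weight alpha k) -> arithmetic_mean x \in c0 (weight alpha k).
Proof.
move=> ha /c0P /cesaro h; apply/c0P.
apply: (squeeze_cvgr (f := fun=> 0) _ _ h).
  apply: nearW => n; rewrite weight_arithmetic_mean// andbT.
  by rewrite mulr_ge0 ?normc_ge0// ltW// weight_gt0.
exact: cvg_cst.
Qed.

Lemma arithmetic_mean_Lambda0 alpha x : increasing_to_infty alpha ->
  x \in Lambda0 alpha -> arithmetic_mean x \in Lambda0 alpha.
Proof.
move=> ha /Lambda0P h; apply/Lambda0P => k k0.
by apply: arithmetic_mean_c0 => //; exact: h.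
Qed.

Definition cesaro_c0 alpha (ha : increasing_to_infty alpha) k
    (x : c0_space alpha k) : c0_space alpha k :=
  C0Space (arithmetic_mean_c0 ha (c0_valP x)).

Definition cesaro_Lambda0 alpha (ha : increasing_to_infty alpha)
    (x : Lambda0_space alpha) : Lambda0_space alpha :=
  Lambda0Space (arithmetic_mean_Lambda0 ha (Lambda0_valP x)).

Lemma arithmetic_mean_linear (a : R[i]) (x y : nat -> R[i]) :
  arithmetic_mean (a *: x + y) = a *: arithmetic_mean x + arithmetic_mean y.
Proof.
apply/funext => n; rewrite /arithmetic_mean/= !seriesEord/=.
rewrite [RHS](_ : _ = a * (n.+1%:R^-1 * \sum_(i < n.+1) x i) +
  n.+1%:R^-1 * \sum_(i < n.+1) y i)//.
by rewrite mulrCA -mulrDr [a * _]mulr_sumr -big_split.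
Qed.

Lemma sup_norm_arithmetic_mean alpha k x : increasing_to_infty alpha ->
  x \in c0 (weight alpha k) ->
  sup_norm (weight alpha k) (arithmetic_mean x) <= sup_norm (weight alpha k) x.
Proof.
move=> ha xc; apply: sup_norm_le => n.
apply: le_trans (weight_arithmetic_mean _ _ _ ha) _.
rewrite /arithmetic_mean/= seriesEord/= ler_pdivrMl//.
apply: (@le_trans _ _ (\sum_(i < n.+1) sup_norm (weight alpha k) x)).
  by apply: ler_sum => i _; exact: sup_norm_ub.
by rewrite sumr_const card_ord mulr_natl.
Qed.

Lemma cesaro_c0_continuous_linear alpha (ha : increasing_to_infty alpha) k :
  continuous_linear (cesaro_c0 ha (k := k)).
Proof.
have lin : linear (cesaro_c0 ha (k := k)).
  by move=> a x y; apply: val_inj; exact: arithmetic_mean_linear.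
split => //; apply: (seminorm_linear_continuous (c0_entourageE alpha k)) => // -[].
by exists tt => x; exact: sup_norm_arithmetic_mean (c0_valP x).
Qed.

Lemma cesaro_Lambda0_continuous_linear alpha (ha : increasing_to_infty alpha) :
  continuous_linear (cesaro_Lambda0 ha).
Proof.
have lin : linear (cesaro_Lambda0 ha).
  by move=> a x y; apply: val_inj; exact: arithmetic_mean_linear.
split => //.
apply: (seminorm_linear_continuous (Lambda0_entourageE alpha)) => // i.
exists i => x; apply: sup_norm_arithmetic_mean => //.
exact: (elimT (Lambda0P _ _) (Lambda0_valP x) i.+1 isT).
Qed.

(* [n.+1%:R] and [alpha n] are the $n$ and $\alpha_n$ of the usual indexing. *)
Definition S_set alpha (k : nat) : set R :=
  [set s | (\sum_(0 <= n <oo)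
    (expR (alpha n / k%:R) / n.+1%:R `^ s)%:E < +oo)%E].

Definition s0 alpha (k : nat) : R := inf (S_set alpha k).

Definition D (r : R) : set R[i]^o :=
  ball ((1 / (2 * r))%:C : R[i]^o) (1 / (2 * r))%:C.

Definition Sigma : set R[i]^o := [set m%:R^-1 | m in [set m | (0 < m)%N]].

End cesaro_operator.

Arguments Sigma {R}.

(* Main.v *)
Require Import Defs.
From mathcomp Require Import all_boot all_order all_algebra.
From mathcomp Require Import complex ring lra.
From mathcomp Require Import all_classical all_reals all_analysis.

(** Everything rests on the recurrence satisfied by the means m = C x of a
    sequence x. If y = mu x - C x, then, with indices starting at 0,

      (mu (i+1) - 1) m_i = mu i m_(i-1) + y_i,

    and conversely x = (y + m) / mu. The position of mu with respect to the disc
    with diameter [0, 1], whose interior is D(1), decides how the two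
    coefficients compare.

    If mu is at distance at least d > 0 from the closed disc, then
    |mu (i+1) - 1| >= i |mu| + d ([off_disc_gap]). As the weights decrease, a
    maximum principle bounds the weighted means of x by those of y over d
    ([mean_recurrence_bound]), and the divergence of the harmonic series makes
    them tend to 0 when y is in c_0(w_k) ([mean_recurrence_cvg0]). So mu is in
    the resolvent set of C on every c_0(w_k) and on their intersection. The
    bound on the resolvent depends on d alone, not even on k, whence the
    equicontinuity of the resolvents near mu and the bound
    sigma^* <= closure of D(1).

    If mu is in D(1), then |mu (i+1) - 1| <= i |mu| exp (- delta / i) for some
    delta > 0 and all large i ([D1_gap]). A solution of the equation
    mu x - C x = (1, 0, 0, ...) would therefore have means that grow at least
    like n^delta. The hypothesis on S_1 means that alpha_n grows at most like
    s log n ([alpha_log_growth]), so elements of the intersection grow more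
    slowly than every positive power of n, and there is no solution
    ([D1_not_surjective]). At mu = 1 the constant sequences are eigenvectors.

    The same logarithmic bound gives s_0(k) <= 1 + s / k, so that the discs
    D(s_0(k)) exhaust D(1) ([D1_bigcup]). Finally, a point that belongs to all
    the resolvent sets of the c_0(w_k) has resolvents that agree on the
    intersection, and they glue to a continuous inverse there
    ([resolvent_c0_Lambda0]). *)

Set Implicit Arguments.
Unset Strict Implicit.
Unset Printing Implicit Defensive.

Import Order.TTheory GRing.Theory Num.Theory.
Import numFieldNormedType.Exports.
Import ComplexField.Normc.

Local Open Scope classical_set_scope.
Local Open Scope ring_scope.
Local Open Scope complex_scope.

(** * Moduli of complex numbers and the disc with diameter [0, 1] *)

Lemma sqr_normc_ReIm (R : realType) (z : R[i]) :
  normc z ^+ 2 = complex.Re z ^+ 2 + complex.Im z ^+ 2.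
Proof. by case: z => a b /=; rewrite sqr_sqrtr// addr_ge0// sqr_ge0. Qed.

Lemma normc_real (R : realType) (x : R) : 0 <= x -> normc x%:C = x.
Proof. by move=> x0; rewrite /= expr0n addr0 sqrtr_sqr ger0_norm. Qed.

Lemma nat_complex (R : realType) (n : nat) : (n%:R : R[i]) = n%:R +i* 0.
Proof. by rewrite -[RHS]/((n%:R)%:C) rmorph_nat. Qed.

Lemma normc_gt0 (R : realType) (z : R[i]) : z != 0 -> 0 < normc z.
Proof.
move=> z0; rewrite lt_neqAle normc_ge0 andbT eq_sym.
by apply: contra z0 => /eqP/eq0_normc ->.
Qed.

Lemma ball_normc (R : realType) (c z : R[i]) (r : R) :
  ball (c : R[i]^o) r%:C (z : R[i]^o) <-> normc (c - z) < r.
Proof. by rewrite -ball_normE /= /ball_/= ltcR. Qed.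

(** The inequality says that Re (1 / l) > r, but it makes sense at l = 0 too. *)
Lemma D_Re_normc (R : realType) (r : R) (l : R[i]) : 0 < r ->
  D r l <-> r * normc l ^+ 2 < complex.Re l.
Proof.
move=> r0; have h0 : 0 < 1 / (2 * r) by rewrite divr_gt0// mulr_gt0.
rewrite /D ball_normc -(@ltr_pXn2r _ 2)// ?nnegrE ?normc_ge0 ?(ltW h0)//.
rewrite !sqr_normc_ReIm; case: l => a b /=.
rewrite -subr_gt0 -[r * _ < a]subr_gt0.
have -> : a - r * (a ^+ 2 + b ^+ 2) =
  r * ((1 / (2 * r)) ^+ 2 - ((1 / (2 * r) - a) ^+ 2 + (0 - b) ^+ 2)).
  by field; rewrite gt_eqF.
by rewrite pmulr_rgt0.
Qed.

Lemma D_subset (R : realType) (r : R) : 1 <= r -> D r `<=` D 1.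
Proof.
move=> r1 l /D_Re_normc => /(_ (lt_le_trans ltr01 r1)) rl.
apply/D_Re_normc => //; apply: le_lt_trans rl.
by rewrite ler_wpM2r// exprn_ge0// normc_ge0.
Qed.

(** The number d is a lower bound of the distance from mu to the closed disc
    with diameter [0, 1]. It is the only quantity on which the resolvent
    estimates depend, which makes them uniform in mu. *)
Definition off_disc {R : realType} (d : R) (mu : R[i]) : Prop :=
  0 < d /\ 1 / 2 + d <= normc (mu - (1 / 2)%:C).

Lemma off_disc_normc (R : realType) (d : R) (mu : R[i]) : off_disc d mu ->
  d <= normc mu.
Proof.
move=> [d0 dmu].
have half : normc ((1 / 2)%:C : R[i]) = 1 / 2. by rewrite normc_real// divr_ge0.
have := le_normcD mu (- (1 / 2)%:C); rewrite normcN half; lra.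
Qed.

Lemma off_disc_neq0 (R : realType) (d : R) (mu : R[i]) : off_disc d mu ->
  mu != 0.
Proof.
move=> dmu; have := off_disc_normc dmu; apply: contraTneq => ->.
by rewrite normc0 -ltNge; case: dmu.
Qed.

(** This is the sharp comparison between the two coefficients of the
    recurrence for the means; at i = 0 it says that |mu - 1| is at least d.
    The modulus of mu (i+1) - 1 is bounded below by its component along mu,
    and |mu|^2 - Re mu factors as (t - 1/2)(t + 1/2) with t = |mu - 1/2|. *)
Lemma off_disc_gap (R : realType) (mu : R[i]) (d : R) : off_disc d mu ->
  forall i : nat, i%:R * normc mu + d <= normc (mu * i.+1%:R - 1).
Proof.
move=> [d0]; set t := normc (mu - _) => td i.
set A := normc mu; set W := normc _.
have t0 : 0 <= t by exact: normc_ge0.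
have W0 : 0 <= W by exact: normc_ge0.
have half : normc ((1 / 2)%:C : R[i]) = 1 / 2. by rewrite normc_real// divr_ge0.
have tA : t <= A + 1 / 2.
  by rewrite -half -(normcN (1/2)%:C); exact: le_normcD.
have At : A <= t + 1 / 2.
  rewrite -half; apply: le_trans (le_normcD _ _); by rewrite subrK.
have A2 : A ^+ 2 = complex.Re mu ^+ 2 + complex.Im mu ^+ 2.
  exact: sqr_normc_ReIm.
have t2 : t ^+ 2 = (complex.Re mu - 1 / 2) ^+ 2 + complex.Im mu ^+ 2.
  by rewrite sqr_normc_ReIm; case: (mu) => a b /=; rewrite subr0.
have W2 : W ^+ 2 =
    (complex.Re mu * i.+1%:R - 1) ^+ 2 + (complex.Im mu * i.+1%:R) ^+ 2.
  rewrite sqr_normc_ReIm nat_complex; case: (mu) => a b /=.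
  by rewrite !mulr0 !subr0 add0r.
have A0 : 0 < A by lra.
have Ada : d * A <= A ^+ 2 - complex.Re mu.
  have -> : A ^+ 2 - complex.Re mu = (t - 1 / 2) * (t + 1 / 2).
    by rewrite -subr_sqr t2 A2; field.
  by apply: ler_pM; lra.
(* The left-hand side is the real part of (mu (i+1) - 1) times the conjugate of
   mu, a product of modulus W A. *)
have WA : i.+1%:R * A ^+ 2 - complex.Re mu <= W * A.
  apply: le_trans (ler_norm _) _.
  rewrite -(@ler_pXn2r _ 2)// ?nnegrE ?mulr_ge0 ?(ltW A0)//.
  rewrite real_normK ?num_real// exprMn W2 A2 -subr_ge0.
  set n := i.+1%:R.
  rewrite (_ : _ - _ = complex.Im mu ^+ 2) ?sqr_ge0//; ring.
rewrite -(ler_pM2r A0); apply: le_trans WA.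
rewrite -natr1; lra.
Qed.

Lemma off_disc_den_neq0 (R : realType) (d : R) (mu : R[i]) : off_disc d mu ->
  forall i : nat, mu * i.+1%:R - 1 != 0.
Proof.
move=> dmu i; have := off_disc_gap dmu i; apply: contraTneq => ->.
by rewrite normc0 -ltNge ltr_wpDl ?mulr_ge0 ?normc_ge0//; case: dmu.
Qed.

(** The whole ball lies off the disc with one constant, as the equicontinuity
    of the resolvents requires. *)
Lemma off_disc_of_notin_closure (R : realType) (l : R[i]) :
  ~ closure (D (1 : R)) (l : R[i]^o) ->
  exists2 d : R, 0 < d &
    forall mu : R[i], ball (l : R[i]^o) d%:C (mu : R[i]^o) -> off_disc d mu.
Proof.
move=> nl.
set c : R[i] := (1 / 2)%:C.
set t := normc (l - c).
have t12 : 1 / 2 < t.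
  rewrite ltNge; apply/negP => tle; apply: nl => U /nbhs_ballP[e /= e0 eU].
  have e1 : 0 < complex.Re e by move: e0; rewrite ltcE => /andP[].
  have eE : e = (complex.Re e)%:C by rewrite RRe_real// gtr0_real.
  (* When l is in the closed disc, c + s (l - c) is in D(1) for every s < 1, and
     the following s makes it a point of the ball of radius e around l. *)
  pose s := Num.max 0 (1 - complex.Re e).
  have s0 : 0 <= s by rewrite le_max lexx.
  have s1 : s < 1 by rewrite gt_max ltr01 gtrBl.
  have sn : normc s%:C = s :> R. by exact: normc_real.
  have sn1 : normc (1 - s)%:C = 1 - s :> R.
    by rewrite normc_real// subr_ge0 ltW.
  exists (c + s%:C * (l - c)); split.
    rewrite /D ball_normc mulr1.
    have -> : (1 / 2)%:C - (c + s%:C * (l - c)) = - (s%:C * (l - c)).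
      by rewrite /c opprD addrA subrr add0r.
    rewrite normcN normcM sn; apply: le_lt_trans (_ : s * (1 / 2) < _).
      by rewrite ler_wpM2l.
    by rewrite gtr_pMl// divr_gt0.
  apply: eU; rewrite eE; apply/ball_normc.
  have -> : l - (c + s%:C * (l - c)) = (1 - s)%:C * (l - c).
    by rewrite rmorphB/= rmorph1; ring.
  rewrite normcM sn1; apply: le_lt_trans (_ : (1 - s) * (1 / 2) < _).
    by rewrite ler_wpM2l// subr_ge0 ltW.
  have : 1 - complex.Re e <= s by rewrite le_max lexx orbT.
  lra.
exists ((t - 1 / 2) / 2) => [|mu /ball_normc lmu]; first by lra.
split; first by lra.
have : t <= normc (l - mu) + normc (mu - c).
  by apply: le_trans (le_normcD _ _); rewrite addrA subrK.
rewrite -/c; lra.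
Qed.

(** * Harmonic sums *)

Lemma series_harmonicS (R : realType) n :
  series (@harmonic R) n.+1 = series harmonic n + n.+1%:R^-1.
Proof. by rewrite /series/= big_nat_recr. Qed.

Lemma series_harmonic_ge0 (R : realType) n : 0 <= series (@harmonic R) n.
Proof. by apply: sumr_ge0 => i _; rewrite /= invr_ge0. Qed.

(** This lets the harmonic sums play the role of the logarithm, and it implies
    that they are unbounded. *)
Lemma natS_le_expR_harmonic (R : realType) n :
  n.+1%:R <= expR (series (@harmonic R) n).
Proof.
elim: n => [|n IH]; first by rewrite /series/= big_nil expR0.
rewrite series_harmonicS expRD.
have -> : n.+2%:R = n.+1%:R * (1 + n.+1%:R^-1) :> R.
  by rewrite mulrDr mulr1 divff ?pnatr_eq0// natr1.
by apply: ler_pM => //; exact: expR_ge1Dx.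
Qed.

Lemma series_harmonic_unbounded (R : realType) (B : R) :
  exists N, forall n, (N <= n)%N -> B < series harmonic n.
Proof.
exists (Num.bound (expR B)) => n Nn; rewrite -ltr_expR.
apply: lt_le_trans (natS_le_expR_harmonic R n).
apply: (lt_le_trans (archi_boundP (expR_ge0 B))).
by rewrite ler_nat (leq_trans Nn).
Qed.

(** * The recurrence satisfied by the means *)

(** The relation between y = mu x - C x and m = C x obtained by eliminating x.
    At i = 0 the term with the predecessor has coefficient zero, so that m
    0.-1 is harmless. *)
Definition mean_recurrence {R : realType} (mu : R[i]) (m y : nat -> R[i]) :=
  forall i : nat, (mu * i.+1%:R - 1) * m i = mu * i%:R * m i.-1 + y i.

Lemma arithmetic_meanS (R : realType) (x : nat -> R[i]) i :
  i.+1%:R * arithmetic_mean x i = i%:R * arithmetic_mean x i.-1 + x i.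
Proof.
rewrite /arithmetic_mean/= mulrA divff ?pnatr_eq0// mul1r.
rewrite /series/= big_nat_recr//=; congr (_ + _).
case: i => [|i]; first by rewrite big_nil mul0r.
by rewrite mulrA divff ?pnatr_eq0// mul1r.
Qed.

Lemma mean_recurrence_cesaro (R : realType) (mu : R[i]) (x : nat -> R[i]) :
  mean_recurrence mu (arithmetic_mean x) (mu *: x - arithmetic_mean x).
Proof.
move=> i; rewrite mulrBl mul1r -(mulrA mu i.+1%:R) arithmetic_meanS.
by rewrite -[(_ - _) i]/(mu * x i - arithmetic_mean x i); ring.
Qed.

Lemma cesaro_mean_recurrence (R : realType) (mu : R[i]) (m y : nat -> R[i]) :
  mu != 0 -> mean_recurrence mu m y -> arithmetic_mean (mu^-1 *: (y + m)) = m.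
Proof.
move=> mu0 rec; apply/funext.
have yE j : y j = (mu * j.+1%:R - 1) * m j - mu * j%:R * m j.-1.
  by rewrite rec addrC addKr.
have nat_neq0 n : n.+1%:R != 0 :> R[i] by rewrite pnatr_eq0.
elim=> [|i IH]; [apply: (mulfI (nat_neq0 0%N))|apply: (mulfI (nat_neq0 i.+1))].
  rewrite arithmetic_meanS -[(_ *: _) _]/(mu^-1 * (y 0%N + m 0%N)) yE.
  by field.
rewrite arithmetic_meanS IH -[(_ *: _) _]/(mu^-1 * (y i.+1 + m i.+1)) yE.
by field.
Qed.

Lemma mean_recurrence_inj (R : realType) (mu : R[i]) (m m' y : nat -> R[i]) :
  (forall i : nat, mu * i.+1%:R - 1 != 0) ->
  mean_recurrence mu m y -> mean_recurrence mu m' y -> m = m'.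
Proof.
move=> nz rec rec'; apply/funext; elim=> [|i IH].
  by apply: (mulfI (nz 0%N)); rewrite rec rec' mulr0 !mul0r.
by apply: (mulfI (nz i.+1)); rewrite rec rec' /= IH.
Qed.

(** Since the weights decrease, they may be carried through the recurrence,
    and the rest is the comparison of coefficients. *)
Lemma mean_recurrence_norm (R : realType) (mu : R[i]) (d : R)
    (m y : nat -> R[i]) (w : nat -> R) :
  off_disc d mu ->
  (forall i, 0 <= w i) -> (forall i j, (i <= j)%N -> w j <= w i) ->
  mean_recurrence mu m y ->
  forall i : nat, (i%:R * normc mu + d) * (w i * normc (m i)) <=
    i%:R * normc mu * (w i.-1 * normc (m i.-1)) + w i * normc (y i).
Proof.
move=> dmu w0 wdec rec i.
rewrite mulrCA.
apply: (@le_trans _ _ (w i * (normc ((mu * i.+1%:R - 1) * m i)))).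
  by rewrite ler_wpM2l// normcM ler_wpM2r ?normc_ge0// off_disc_gap.
rewrite rec; apply: (@le_trans _ _
    (w i * (i%:R * normc mu * normc (m i.-1) + normc (y i)))).
  rewrite ler_wpM2l//; apply: le_trans (le_normcD _ _) _.
  by rewrite !normcM normc_nat (mulrC (normc mu)).
rewrite mulrDr lerD2r mulrCA ler_wpM2l ?mulr_ge0 ?normc_ge0//.
by rewrite ler_wpM2r ?normc_ge0// wdec// leq_pred.
Qed.

(** A maximum principle: if the weighted mean at i - 1 is at most B / d, the
    right-hand side of the scalar inequality is at most (i |mu| + d) B / d. *)
Lemma mean_recurrence_bound (R : realType) (mu : R[i]) (d B : R)
    (m y : nat -> R[i]) (w : nat -> R) :
  off_disc d mu ->
  (forall i, 0 <= w i) -> (forall i j, (i <= j)%N -> w j <= w i) ->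
  mean_recurrence mu m y -> (forall i, w i * normc (y i) <= B) ->
  forall i, w i * normc (m i) <= B / d.
Proof.
move=> dmu w0 wdec rec yB i; have [d0 _] := dmu.
have B0 : 0 <= B by apply: le_trans (yB 0%N); rewrite mulr_ge0 ?normc_ge0.
have step j : w j.-1 * normc (m j.-1) <= B / d \/ j = 0%N ->
    w j * normc (m j) <= B / d.
  move=> h; have A0 : 0 <= j%:R * normc mu by rewrite mulr_ge0 ?normc_ge0.
  have Ad : 0 < j%:R * normc mu + d by rewrite ltr_wpDl.
  rewrite -(ler_pM2l Ad).
  apply: le_trans (mean_recurrence_norm dmu w0 wdec rec j) _.
  rewrite mulrDl (mulrC d) divfK ?gt_eqF//; apply: lerD => //.
  by case: h => [h|->]; [rewrite ler_wpM2l|rewrite !mul0r].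
by elim: i => [|i IH]; apply: step; [right|left].
Qed.

(** The constant envelope B / d of the maximum principle is replaced by e / 2
    + K / a_n, where a_n grows like (d / |mu|) times the harmonic sum. The
    divergence of the harmonic series is what forces the limit 0. *)
Lemma mean_recurrence_cvg0 (R : realType) (mu : R[i]) (d : R)
    (m y : nat -> R[i]) (w : nat -> R) :
  off_disc d mu ->
  (forall i, 0 <= w i) -> (forall i j, (i <= j)%N -> w j <= w i) ->
  mean_recurrence mu m y -> y \in c0 w -> m \in c0 w.
Proof.
move=> dmu w0 wdec rec /c0P y0; apply/c0P; have [d0 _] := dmu.
have := normc_gt0 (off_disc_neq0 dmu).
set A := normc mu => A0; set M := fun n => w n * normc (m n).
have M0 n : 0 <= M n by rewrite mulr_ge0 ?normc_ge0.
pose a (n : nat) : R := 1 + d / A * series harmonic n.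
have a1 n : 1 <= a n.
  by rewrite lerDl mulr_ge0 ?series_harmonic_ge0// divr_ge0 // ltW.
have a0 n : 0 < a n by apply: lt_le_trans (a1 n).
apply/cvgrPdist_le => e e0.
have e20 : 0 < e / 2 by rewrite divr_gt0.
have /cvgrPdist_le/(_ (e / 2 * d)) := y0; rewrite mulr_gt0//.
move=> /(_ isT)[N _ hN].
have yN n : (N <= n)%N -> w n * normc (y n) <= e / 2 * d.
  by move=> /hN /=; rewrite sub0r normrN; exact/le_trans/ler_norm.
pose K := a N * M N.
have K0 : 0 <= K by rewrite mulr_ge0// ltW.
(* An upper envelope: the choice of a makes the right-hand side a supersolution
   of the recurrence inequality, with surplus K d (a_n - 1) / (a_n a_(n+1)). *)
have claim n : (N <= n)%N -> M n <= e / 2 + K / a n.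
  elim: n => [|n IH].
    rewrite leqn0 => /eqP NE; rewrite /K NE mulrAC divff ?gt_eqF// mul1r.
    by rewrite lerDr ltW.
  rewrite leq_eqVlt => /orP[/eqP NE|Nn].
    by rewrite /K NE mulrAC divff ?gt_eqF// mul1r lerDr ltW.
  have nA : 0 < n.+1%:R * A by rewrite mulr_gt0.
  have nAd : 0 < n.+1%:R * A + d by rewrite addr_gt0.
  have {}IH := IH Nn.
  rewrite -(ler_pM2l nAd).
  apply: le_trans (mean_recurrence_norm dmu w0 wdec rec n.+1) _.
  apply: (@le_trans _ _ (n.+1%:R * A * (e / 2 + K / a n) + e / 2 * d)).
    by apply: lerD; [rewrite ler_wpM2l ?(ltW nA)|exact: (yN _ (leqW Nn))].
  rewrite -subr_ge0.
  have aS : a n.+1 = a n + d / A / n.+1%:R.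
    by rewrite /a series_harmonicS mulrDr addrA.
  set T := (X in 0 <= X).
  have -> : T = K * d * (a n - 1) / (a n * a n.+1).
    rewrite /T aS.
    have : a n != 0 by rewrite gt_eqF.
    have : a n + d / A / n.+1%:R != 0 by rewrite -aS gt_eqF.
    have : A != 0 by rewrite gt_eqF.
    have : n.+1%:R != 0 :> R by rewrite pnatr_eq0.
    move: (a n) (n.+1%:R) => u v v0 A_0 u1 u0; field.
    rewrite v0 A_0 u0 andbT /=.
    rewrite (_ : _ + d = (u + d / A / v) * (A * v)).
      by rewrite !mulf_neq0.
    by field; rewrite ?v0 ?A_0.
  apply: divr_ge0; last by apply: mulr_ge0; apply: ltW.
  by apply: mulr_ge0; [apply: mulr_ge0 => //; exact: ltW|rewrite subr_ge0].
have [P hP] := series_harmonic_unbounded (K / (e / 2) / (d / A)).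
near=> n.
have Nn : (N <= n)%N by near: n; exact: nbhs_infty_ge.
have Pn : (P <= n)%N by near: n; exact: nbhs_infty_ge.
rewrite sub0r normrN ger0_norm//; apply: le_trans (claim n Nn) _.
rewrite [leRHS]splitr lerD2l ler_pdivrMr// [leRHS]mulrC -(ler_pdivrMr _ _ e20).
have {hP Pn} := hP n Pn; rewrite (ltr_pdivrMr _ _ (divr_gt0 d0 A0)) => h.
by apply: ltW; apply: (lt_trans h); rewrite /a mulrC ltrDr.
Unshelve. all: by end_near. Qed.

(** * The inverse of mu - C on sequences *)

Fixpoint cesaro_mean_solution {R : realType} (mu : R[i]) (y : nat -> R[i])
    (i : nat) : R[i] :=
  if i is j.+1 then (mu * i%:R * cesaro_mean_solution mu y j + y i) /
                    (mu * i.+1%:R - 1)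
  else y 0%N / (mu - 1).

Definition cesaro_resolvent {R : realType} (mu : R[i]) (y : nat -> R[i]) :=
  mu^-1 *: (y + cesaro_mean_solution mu y).

Lemma cesaro_mean_solutionP (R : realType) (mu : R[i]) (y : nat -> R[i]) :
  (forall i : nat, mu * i.+1%:R - 1 != 0) ->
  mean_recurrence mu (cesaro_mean_solution mu y) y.
Proof.
move=> nz [|i] /=; last by rewrite mulrC divfK.
by rewrite mulr0 mul0r add0r mulr1 mulrC divfK//; have := nz 0%N; rewrite mulr1.
Qed.

Lemma cesaro_resolventK (R : realType) (mu : R[i]) (y : nat -> R[i]) :
  mu != 0 -> (forall i : nat, mu * i.+1%:R - 1 != 0) ->
  mu *: cesaro_resolvent mu y - arithmetic_mean (cesaro_resolvent mu y) = y.
Proof.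
move=> mu0 nz.
rewrite /cesaro_resolvent.
rewrite (cesaro_mean_recurrence mu0 (cesaro_mean_solutionP y nz)).
by rewrite scalerA divff// scale1r addrK.
Qed.

Lemma cesaroK_resolvent (R : realType) (mu : R[i]) (x : nat -> R[i]) :
  mu != 0 -> (forall i : nat, mu * i.+1%:R - 1 != 0) ->
  cesaro_resolvent mu (mu *: x - arithmetic_mean x) = x.
Proof.
move=> mu0 nz; rewrite /cesaro_resolvent.
rewrite (mean_recurrence_inj nz (cesaro_mean_solutionP _ nz)
  (mean_recurrence_cesaro mu x)).
by rewrite subrK scalerA mulVf// scale1r.
Qed.

Lemma cesaro_resolvent_c0 (R : realType) (mu : R[i]) (d : R) (w : nat -> R)
    (y : nat -> R[i]) :
  off_disc d mu ->
  (forall i, 0 <= w i) -> (forall i j, (i <= j)%N -> w j <= w i) ->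
  y \in c0 w -> cesaro_resolvent mu y \in c0 w.
Proof.
move=> dmu w0 wdec yc; rewrite rpredZ// rpredD//.
exact: (mean_recurrence_cvg0 dmu w0 wdec
  (cesaro_mean_solutionP y (off_disc_den_neq0 dmu))).
Qed.

(** The bound comes from mu x = y + C x, where C x is bounded by y / d and
    |mu| is at least d. *)
Lemma cesaro_a_priori_bound (R : realType) (mu : R[i]) (d : R) (w : nat -> R)
    (x : nat -> R[i]) :
  off_disc d mu ->
  (forall i, 0 <= w i) -> (forall i j, (i <= j)%N -> w j <= w i) ->
  mu *: x - arithmetic_mean x \in c0 w ->
  sup_norm w x <= d^-1 * (1 + d^-1) * sup_norm w (mu *: x - arithmetic_mean x).
Proof.
move=> dmu w0 wdec; set y := _ - _ => yc.
have [d0 _] := dmu.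
have yB n := sup_norm_ub n yc; move: (sup_norm w y) yB => B yB.
have mB := mean_recurrence_bound dmu w0 wdec
  (mean_recurrence_cesaro mu x) yB.
apply: sup_norm_le => n.
have nmu0 : 0 < normc mu by apply: lt_le_trans (off_disc_normc dmu).
have : normc mu * (w n * normc (x n)) <= B + B / d.
  rewrite mulrCA -normcM.
  have -> : mu * x n = y n + arithmetic_mean x n.
    by rewrite -[y n]/(mu * x n - arithmetic_mean x n) subrK.
  apply: (@le_trans _ _ (w n * (normc (y n) + normc (arithmetic_mean x n)))).
    by rewrite ler_wpM2l// le_normcD.
  by rewrite mulrDr lerD.
rewrite -ler_pdivlMl// => /le_trans; apply.
have B0 : 0 <= B by apply: le_trans (yB 0%N); rewrite mulr_ge0 ?normc_ge0.
rewrite -mulrA; apply: ler_pM => //.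
- by rewrite invr_ge0 normc_ge0.
- by rewrite addr_ge0// divr_ge0// ltW.
- by rewrite lef_pV2 ?posrE//; exact: off_disc_normc.
- by rewrite mulrDl mul1r mulrC.
Qed.

(** * Continuity and equicontinuity of resolvents *)

Lemma resolvent_linear (K : comNzRingType) (V : lmodType K) (T S : V -> V)
    (l : K) :
  linear T -> (forall x, S (l *: x - T x) = x) ->
  (forall x, l *: S x - T (S x) = x) -> linear S.
Proof.
move=> linT SK KS a x y; rewrite -[RHS]SK; congr S.
rewrite linT scalerDr scalerA mulrC -scalerA opprD addrACA -scalerBr.
by rewrite !KS.
Qed.

(** One constant for all the operators of the family, and for all the
    seminorms, gives equicontinuity; a family with one member gives
    continuity. *)
Lemma seminorm_bounded_equicontinuous (R : realType) (I : eqType)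
    (X : tvsType R[i]) (p : I -> X -> R) (J : Type) (W : set J)
    (F : J -> X -> X) (K : R) :
  (forall i, seminorm (p i)) ->
  entourage = seminorm_entourage p ->
  (forall j, W j -> linear (F j)) ->
  (forall j, W j -> forall i x, p i (F j x) <= K * p i x) ->
  @equicontinuous X (tvs_puniform X) J W F.
Proof.
move=> p_semi entE linF FK x A.
rewrite [entourage](_ : _ = seminorm_entourage p)//.
move=> [s [e [e0 sA]]].
have K0 : 0 < 1 + `|K| by rewrite ltr_pwDl.
have := @near_seminorm R I X p entE x s (e / (1 + `|K|)) (divr_gt0 e0 K0).
apply: filterS => y hy j Wj; apply: sA => i si /=.
have FB : F j x - F j y = F j (x - y).
  by rewrite addrC -scaleN1r -(linF j Wj) scaleN1r addrC.
rewrite -[_ - _]/(F j x - F j y) FB; apply: le_lt_trans (FK j Wj i _) _.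
have := hy i si; rewrite ltr_pdivlMr// mulrC; apply: le_lt_trans.
by rewrite ler_wpM2r ?seminorm_ge0// (le_trans (ler_norm K))// lerDr.
Qed.

(** The lower bound on l - T is what makes its algebraic inverse continuous. *)
Lemma bounded_below_is_resolvent (R : realType) (I : eqType)
    (X : tvsType R[i]) (p : I -> X -> R) (T S : X -> X) (l : R[i]) (K : R) :
  (forall i, seminorm (p i)) -> entourage = seminorm_entourage p ->
  linear T -> (forall x, S (l *: x - T x) = x) ->
  (forall x, l *: S x - T (S x) = x) ->
  (forall i x, p i x <= K * p i (l *: x - T x)) ->
  is_resolvent T l S.
Proof.
move=> p_semi entE linT SK KS lb; split => //; split.
  exact: resolvent_linear KS.
have SB (j : unit) : setT j -> forall i x, p i (S x) <= K * p i x.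
  by move=> _ i x; have := lb i (S x); rewrite KS.
have linS (j : unit) : setT j -> linear S.
  by move=> _; exact: resolvent_linear KS.
exact: (equicontinuous_continuous
  (seminorm_bounded_equicontinuous p_semi entE linS SB) (i := tt)).
Qed.

Lemma is_resolvent_resolvent (R : realType) (X : tvsType R[i]) (T : X -> X)
    (l : R[i]) : resolvent_set T l -> is_resolvent T l (resolvent T l).
Proof. by move=> [S TS]; exact: (xgetPex (fun=> 0) (ex_intro _ S TS)). Qed.

Lemma off_disc_resolvent_c0 (R : realType) (alpha : nat -> R)
    (ha : increasing_to_infty alpha) (k : nat) (d : R) (mu : R[i]) :
  off_disc d mu -> resolvent_set (cesaro_c0 ha (k := k)) mu.
Proof.
move=> dmu.
have w0 i : 0 <= weight alpha k i by rewrite ltW// weight_gt0.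
have wdec := weight_nonincreasing k ha.
pose S (y : c0_space alpha k) : c0_space alpha k :=
  C0Space (cesaro_resolvent_c0 dmu w0 wdec (c0_valP y)).
have mu0 := off_disc_neq0 dmu; have nz := off_disc_den_neq0 dmu.
exists S.
apply: (@bounded_below_is_resolvent R unit _ (@c0_norms R alpha k) _ _ _
  (d^-1 * (1 + d^-1))).
- by move=> i; exact: c0_norm_seminorm.
- exact: c0_entourageE.
- by case: (cesaro_c0_continuous_linear ha k).
- by move=> x; apply: val_inj; exact: cesaroK_resolvent.
- by move=> x; apply: val_inj; exact: cesaro_resolventK.
- move=> ? x; apply: (cesaro_a_priori_bound dmu w0 wdec).
  exact: (c0_valP (mu *: x - cesaro_c0 ha x)).
Qed.

Lemma Lambda0_c0_valP (R : realType) (alpha : nat -> R)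
    (x : Lambda0_space alpha) (i : nat) :
  Lambda0_val x \in c0 (weight alpha i.+1).
Proof. exact: (elimT (Lambda0P _ _) (Lambda0_valP x)). Qed.

Lemma Lambda0_norms_semi (R : realType) (alpha : nat -> R) i :
  seminorm (Lambda0_norms (alpha := alpha) i).
Proof. exact: Lambda0_norm_seminorm. Qed.

Lemma cesaro_Lambda0_a_priori_bound (R : realType) (alpha : nat -> R)
    (ha : increasing_to_infty alpha) (d : R) (mu : R[i]) :
  off_disc d mu -> forall i (x : Lambda0_space alpha),
  Lambda0_norms i x <=
    d^-1 * (1 + d^-1) * Lambda0_norms i (mu *: x - cesaro_Lambda0 ha x).
Proof.
move=> dmu i x; apply: (cesaro_a_priori_bound dmu).
- by move=> n; rewrite ltW// weight_gt0.
- exact: weight_nonincreasing.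
- exact: (Lambda0_c0_valP (mu *: x - cesaro_Lambda0 ha x)).
Qed.

Lemma off_disc_resolvent_Lambda0 (R : realType) (alpha : nat -> R)
    (ha : increasing_to_infty alpha) (d : R) (mu : R[i]) :
  off_disc d mu -> resolvent_set (cesaro_Lambda0 ha) mu.
Proof.
move=> dmu.
have SL (y : Lambda0_space alpha) :
    cesaro_resolvent mu (Lambda0_val y) \in Lambda0 alpha.
  apply/Lambda0P => k k0; apply: (cesaro_resolvent_c0 dmu).
  - by move=> n; rewrite ltW// weight_gt0.
  - exact: weight_nonincreasing.
  - exact: (elimT (Lambda0P _ _) (Lambda0_valP y)).
have mu0 := off_disc_neq0 dmu; have nz := off_disc_den_neq0 dmu.
exists (fun y => Lambda0Space (SL y)).
apply: (@bounded_below_is_resolvent R nat _ (@Lambda0_norms R alpha) _ _ _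
  (d^-1 * (1 + d^-1))).
- exact: Lambda0_norms_semi.
- exact: Lambda0_entourageE.
- by case: (cesaro_Lambda0_continuous_linear ha).
- by move=> x; apply: val_inj; exact: cesaroK_resolvent.
- by move=> x; apply: val_inj; exact: cesaro_resolventK.
- exact: cesaro_Lambda0_a_priori_bound.
Qed.

Lemma off_disc_resolvent_equicontinuous (R : realType) (alpha : nat -> R)
    (ha : increasing_to_infty alpha) (d : R) (W : set R[i]) :
  W `<=` off_disc d ->
  @equicontinuous _ (tvs_puniform (Lambda0_space alpha)) _ W
    (resolvent (cesaro_Lambda0 ha)).
Proof.
move=> Wd.
have Wres l : W l -> is_resolvent (cesaro_Lambda0 ha) l
    (resolvent (cesaro_Lambda0 ha) l).
  move=> /Wd dl; apply: is_resolvent_resolvent.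
  exact: off_disc_resolvent_Lambda0 dl.
apply: (@seminorm_bounded_equicontinuous R nat _ (@Lambda0_norms R alpha) _ _ _
  (d^-1 * (1 + d^-1))).
- exact: Lambda0_norms_semi.
- exact: Lambda0_entourageE.
- by move=> l /Wres[[]].
- move=> l Wl i x; have [_ _ KS] := Wres l Wl.
  by have := cesaro_Lambda0_a_priori_bound ha (Wd _ Wl)
    i (resolvent (cesaro_Lambda0 ha) l x); rewrite KS.
Qed.

(** * The exponents s_0(k) *)

Lemma nneseries_lty_bounded (R : realType) (u : nat -> R) :
  (forall n, 0 <= u n) ->
  (\sum_(0 <= n <oo) (u n)%:E < +oo)%E <->
  exists B, forall n, \sum_(0 <= i < n) u i <= B.
Proof.
move=> u0; have ue0 n : (0 <= (u n)%:E)%E by rewrite lee_fin.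
have s0 : (0 <= \sum_(0 <= n <oo) (u n)%:E)%E.
  by apply: nneseries_ge0 => *; exact: ue0.
split=> [foo|[B uB]].
  exists (fine (\sum_(0 <= n <oo) (u n)%:E)%E) => n.
  rewrite -lee_fin fineK ?ge0_fin_numE// -sumEFin.
  by apply: nneseries_lim_ge => i _ _; exact: ue0.
apply: (@le_lt_trans _ _ B%:E); last exact: ltry.
apply: lime_le; first by apply: is_cvg_nneseries => i _ _; exact: ue0.
by apply: nearW => n; rewrite sumEFin lee_fin.
Qed.

Lemma powR_natS (R : realType) (n : nat) (s : R) :
  n.+1%:R `^ s = expR (s * ln n.+1%:R).
Proof. by rewrite /powR pnatr_eq0. Qed.

Lemma expR_alpha_ge1 (R : realType) (alpha : nat -> R) (k n : nat) :
  increasing_to_infty alpha -> 1 <= expR (alpha n / k%:R).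
Proof.
move=> [a1 _ _]; rewrite -expR0 ler_expR divr_ge0//.
exact: (le_trans ler01 (ltW (a1 n))).
Qed.

(** For s < 1 the terms dominate those of the harmonic series, as alpha is
    positive. *)
Lemma S_set_ge1 (R : realType) (alpha : nat -> R) (k : nat) :
  increasing_to_infty alpha -> lbound (S_set alpha k) 1.
Proof.
move=> ha s; rewrite /S_set/= leNgt => + ; apply: contraPN => s1.
have e1 n := expR_alpha_ge1 k n ha.
move/nneseries_lty_bounded => [].
  by move=> n; rewrite divr_ge0 ?powR_ge0 ?expR_ge0.
move=> B hB; have [N hN] := series_harmonic_unbounded B.
have := hN N (leqnn N); rewrite ltNge => /negP; apply.
apply: le_trans (hB N); apply: ler_sum => i _ /=.
rewrite -[leLHS]mul1r; apply: ler_pM => //.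
rewrite lef_pV2 ?posrE ?powR_gt0//.
by rewrite ler1_powR ?ler1n// ltW.
Qed.

(** The terms of a convergent series are bounded, so exp (alpha_n) grows at
    most polynomially. *)
Lemma alpha_log_growth (R : realType) (alpha : nat -> R) :
  increasing_to_infty alpha -> S_set alpha 1 !=set0 ->
  exists c s : R, [/\ 0 <= c, 0 <= s &
    forall n, alpha n <= c + s * ln n.+1%:R].
Proof.
move=> ha [s Ss]; have s1 := S_set_ge1 ha Ss.
move: Ss; rewrite /S_set/= => /nneseries_lty_bounded[].
  by move=> n; rewrite divr_ge0 ?powR_ge0 ?expR_ge0.
move=> B hB; exists `|B|, s; split => //; first exact: le_trans s1.
move=> n; rewrite -ler_expR expRD -powR_natS -ler_pdivrMr ?powR_gt0//.
apply: (@le_trans _ _ B); last first.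
  by apply: le_trans (expR_ge1Dx _); rewrite (le_trans (ler_norm B))// lerDr.
apply: le_trans (hB n.+1); rewrite big_nat_recr//= divr1 lerDr.
by apply: sumr_ge0 => i _; rewrite divr_ge0 ?powR_ge0 ?expR_ge0.
Qed.

Lemma ln_natS_le (R : realType) (n : nat) :
  ln n.+1%:R <= ln n.+2%:R - n.+2%:R^-1 :> R.
Proof.
have n2 : (0 : R) < n.+2%:R by [].
have i1 : n.+2%:R^-1 < 1 :> R by rewrite invf_lt1// ltr1n.
have -> : n.+1%:R = n.+2%:R * (1 - n.+2%:R^-1) :> R.
  by rewrite mulrBr mulr1 divff ?pnatr_eq0// -[X in X - _]natr1 addrK.
rewrite lnM ?posrE// ?subr_gt0// lerD2l; apply: le_ln1Dx.
by rewrite ltrN2.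
Qed.

(** The sum telescopes: n^(-1-e) is at most the decrease of n^(-e) / e from n
    - 1 to n. *)
Lemma riemann_series_bounded (R : realType) (e : R) : 0 < e -> forall n,
  \sum_(0 <= i < n) expR (- (1 + e) * ln i.+1%:R) <= 1 + e^-1.
Proof.
move=> e0.
have step n : \sum_(0 <= i < n.+1) expR (- (1 + e) * ln i.+1%:R)
    + expR (- e * ln n.+1%:R) / e <= 1 + e^-1.
  elim: n => [|n IH].
    by rewrite big_nat1 ln1 !mulr0 expR0 div1r.
  apply: le_trans IH; rewrite big_nat_recr//= -addrA lerD2l.
  set L := ln n.+2%:R.
  have n2 : (0 : R) < n.+2%:R by [].
  have -> : expR (- (1 + e) * L) = expR (- e * L) / n.+2%:R.
    rewrite (_ : - (1 + e) * L = - e * L - L); last by ring.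
    by rewrite expRB lnK// posrE.
  apply: (@le_trans _ _ (expR (- e * L) * expR (e / n.+2%:R) / e)).
    rewrite -[X in X + _]mulr1 -!mulrA -mulrDr ler_wpM2l ?expR_ge0//.
    rewrite mulr1.
    rewrite ler_pdivlMr// mulrDl mulVf ?gt_eqF// addrC mulrC.
    exact: expR_ge1Dx.
  rewrite ler_wpM2r ?invr_ge0 ?(ltW e0)// -expRD ler_expR.
  have := ler_wpM2l (ltW e0) (ln_natS_le R n); rewrite -/L.
  rewrite mulrBr !mulNr.
  move: (e * ln _) (e * L) (e / _) => u v v'; lra.
case=> [|n]; first by rewrite big_nil addr_ge0// invr_ge0 ltW.
by apply: le_trans (step n); rewrite lerDl divr_ge0 ?expR_ge0 ?(ltW e0).
Qed.

(** Dividing alpha by k divides its logarithmic growth rate s by k, so that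
    s_0(k) is at most 1 + s / k. *)
Lemma s0_lt (R : realType) (alpha : nat -> R) (t : R) :
  increasing_to_infty alpha -> S_set alpha 1 !=set0 -> 1 < t ->
  exists2 k, (0 < k)%N & s0 alpha k < t.
Proof.
move=> ha hS t1; have [c [s [c0 s0 hc]]] := alpha_log_growth ha hS.
pose e := (t - 1) / 3.
have e0 : 0 < e by rewrite divr_gt0// subr_gt0.
pose k := (Num.bound (s / e)).+1.
have k0 : (0 : R) < k%:R by [].
have ske : s / k%:R <= e.
  rewrite ler_pdivrMr// mulrC -ler_pdivrMr//.
  have /archi_boundP/ltW/le_trans : 0 <= s / e by rewrite divr_ge0// ltW.
  by apply; rewrite ler_nat.
exists k => //; apply: (@le_lt_trans _ _ (1 + e + e)); last by rewrite /e; lra.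
apply: ge_inf; first by exists 1; exact: S_set_ge1.
rewrite /S_set/=; apply/nneseries_lty_bounded.
  by move=> n; rewrite divr_ge0 ?powR_ge0 ?expR_ge0.
exists (expR (c / k%:R) * (1 + e^-1)) => n.
apply: (le_trans _ (ler_wpM2l _ (riemann_series_bounded e0 n)));
  last exact: expR_ge0.
rewrite mulr_sumr; apply: ler_sum => i _.
rewrite powR_natS -expRB -expRD ler_expR.
have l0 : 0 <= ln i.+1%:R :> R by rewrite ln_ge0// ler1n.
have : alpha i / k%:R <= c / k%:R + e * ln i.+1%:R.
  apply: (@le_trans _ _ (c / k%:R + s / k%:R * ln i.+1%:R)).
    by rewrite mulrAC -mulrDl ler_wpM2r ?invr_ge0// (ltW k0).
  by rewrite lerD2l ler_wpM2r.
move: (ln _) => l; lra.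
Qed.

Lemma s0_ge1 (R : realType) (alpha : nat -> R) (k : nat) :
  increasing_to_infty alpha -> S_set alpha k !=set0 -> 1 <= s0 alpha k.
Proof. by move=> ha Sk; apply: lb_le_inf => //; exact: S_set_ge1. Qed.

Lemma S_set_subset (R : realType) (alpha : nat -> R) (k : nat) :
  increasing_to_infty alpha -> (0 < k)%N -> S_set alpha 1 `<=` S_set alpha k.
Proof.
move=> [a1 _ _] k0 s; rewrite /S_set/=; apply: le_lt_trans.
apply: lee_nneseries => n.
  by rewrite lee_fin divr_ge0 ?powR_ge0 ?expR_ge0.
move=> _; rewrite lee_fin ler_wpM2r ?invr_ge0 ?powR_ge0// ler_expR divr1.
have an0 : 0 <= alpha n by exact: (le_trans ler01 (ltW (a1 n))).
by rewrite ler_pdivrMr ?ltr0n// ler_peMr// ler1n.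
Qed.

(** The discs exhaust D(1) because s_0(k) is at least 1 and comes arbitrarily
    close to 1; the points 1 / m with m > 1 are in D(1). *)
Lemma D1_bigcup (R : realType) (alpha : nat -> R)
    (ha : increasing_to_infty alpha) (hS : S_set alpha 1 !=set0) :
  D 1 `|` [set 1] =
    (\bigcup_(k in [set k | (0 < k)%N]) D (s0 alpha k)) `|` Sigma.
Proof.
apply/seteqP; split=> [l [Dl|->]|l [[k /= k0 Dl]|[m /= m0 <-]]].
- left; have /D_Re_normc := Dl => /(_ ltr01); rewrite mul1r => ln.
  have l0 : 0 < normc (l : R[i]) ^+ 2.
    apply: exprn_gt0; apply: normc_gt0; apply: contraTneq ln => ->.
    by rewrite normc0 expr0n /= ltxx.
  have [|k k0 sk] := @s0_lt R alpha
    (complex.Re (l : R[i]) / normc (l : R[i]) ^+ 2) ha hS.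
    by rewrite ltr_pdivlMr// mul1r.
  exists k => //; apply/D_Re_normc.
    apply: (lt_le_trans ltr01); apply: s0_ge1 => //.
    by have [s] := hS; exists s; exact: S_set_subset.
  by rewrite -ltr_pdivlMr.
- by right; exists 1%N => //=; rewrite invr1.
- left; apply: D_subset Dl; apply: s0_ge1 => //.
  by have [s] := hS; exists s; exact: S_set_subset.
- case: m m0 => [//|[|m]] _; first by right; rewrite invr1.
  left; apply/D_Re_normc => //.
  rewrite mul1r normcV normc_nat nat_complex /= expr0n addr0.
  have -> : m.+2%:R / m.+2%:R ^+ 2 = m.+2%:R^-1 :> R by field.
  by rewrite expr2 gtr_pMl ?invr_gt0// invf_lt1// ltr1n.
Qed.

(** * Points of the spectrum *)

Lemma weight_cvg0 (R : realType) (alpha : nat -> R) (k : nat) :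
  increasing_to_infty alpha -> (0 < k)%N -> weight alpha k @ \oo --> (0 : R).
Proof.
move=> [_ _ ay] k0; apply/cvgrPdist_le => e e0.
have K0 : (0 : R) < k%:R by rewrite ltr0n.
near=> n.
rewrite sub0r normrN ger0_norm ?(ltW (weight_gt0 _ _ _))//.
rewrite /weight -(@lnK _ e) ?posrE// ler_expR mulNr lerNl ler_pdivlMr//.
near: n; move/cvgryPge : ay; apply.
Unshelve. all: by end_near. Qed.

Lemma finitely_supported_Lambda0 (R : realType) (alpha : nat -> R)
    (x : nat -> R[i]) (N : nat) :
  (forall n, (N <= n)%N -> x n = 0) -> x \in Lambda0 alpha.
Proof.
move=> xN; apply/Lambda0P => k k0; apply/c0P; apply: cvg_near_cst.
by near=> n; rewrite xN ?normc0 ?mulr0//; near: n; exact: nbhs_infty_ge.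
Unshelve. all: by end_near. Qed.

(** The constant sequences are fixed by the averaging, and they belong to the
    space because the weights tend to 0. *)
Lemma one_spectrum (R : realType) (alpha : nat -> R)
    (ha : increasing_to_infty alpha) : spectrum (cesaro_Lambda0 ha) 1.
Proof.
move=> [S [[linS _] SK _]].
have oneL : (fun=> 1 : R[i]) \in Lambda0 alpha.
  apply/Lambda0P => k k0; apply/c0P; rewrite normc1.
  under eq_fun do rewrite mulr1; exact: weight_cvg0.
pose x := Lambda0Space oneL.
have Cx : cesaro_Lambda0 ha x = x.
  apply: val_inj; apply/funext => n /=.
  rewrite /arithmetic_mean/= /series/= sumr_const_nat subn0.
  by rewrite mulVf// pnatr_eq0.
have S0 : S 0 = 0 by have := linS (-1) 0 0; rewrite !scaleN1r !addNr.
have := SK x; rewrite Cx scale1r subrr S0.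
move=> /(congr1 (fun z => Lambda0_val z 0%N)) /= /esym/eqP.
by rewrite oner_eq0.
Qed.

(** For l in D(1) the ratio of consecutive means in the homogeneous recurrence
    has modulus at least exp (delta / i) for large i, as opposed to what
    happens off the disc. *)
Lemma D1_gap (R : realType) (l : R[i]) : D 1 (l : R[i]^o) ->
  exists2 delta : R, 0 < delta & exists N, forall i : nat, (N <= i)%N ->
    normc (l * i.+1%:R - 1) <= normc l * i%:R * expR (- (delta / i%:R)).
Proof.
move=> /D_Re_normc => /(_ ltr01); rewrite mul1r => Dl.
have A2 := sqr_normc_ReIm l.
have Agt0 : 0 < normc l.
  apply: normc_gt0; apply: contraTneq Dl => ->.
  by rewrite normc0 expr0n /= ltxx.
set A := normc l in Dl A2 Agt0 *; set a := complex.Re l in Dl A2 *.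
have l0 : 0 < A ^+ 2 by exact: exprn_gt0.
have A_ge0 : 0 <= A by exact: ltW.
(* The quadratic terms of the squares cancel, and this delta uses up half of the
   slope 2 (a - |l|^2) of what remains. *)
pose delta := (a - A ^+ 2) / (2 * A ^+ 2).
have d0 : 0 < delta by rewrite divr_gt0 ?subr_gt0 ?mulr_gt0.
exists delta => //.
pose b := (A ^+ 2 - 2 * a + 1) / (a - A ^+ 2).
have [N1 hN1] : exists N : nat, forall i, (N <= i)%N -> b <= i%:R.
  exists (Num.bound `|b|) => i Ni; rewrite (le_trans (ler_norm b))//.
  by rewrite (le_trans (ltW (archi_boundP (normr_ge0 b))))// ler_nat.
exists N1.+1 => i Ni.
have i0 : (0 : R) < i%:R by rewrite ltr0n (leq_trans _ Ni).
have /hN1 bi : (N1 <= i)%N by exact: ltnW.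
rewrite -(@ler_pXn2r _ 2)// ?nnegrE ?normc_ge0 ?mulr_ge0 ?expR_ge0//.
apply: (@le_trans _ _ (A ^+ 2 * i%:R ^+ 2 * (1 - 2 * (delta / i%:R)))); last first.
  rewrite !exprMn ler_wpM2l ?mulr_ge0 ?sqr_ge0//.
  rewrite -expRM_natl; apply: le_trans (expR_ge1Dx _).
  by rewrite mulrN.
have W2 : normc (l * i.+1%:R - 1) ^+ 2 =
    A ^+ 2 * (i%:R + 1) ^+ 2 - 2 * (i%:R + 1) * a + 1.
  rewrite sqr_normc_ReIm A2 nat_complex /a natr1; case: (l) => u v /=.
  by rewrite !mulr0 !subr0 add0r; ring.
rewrite W2 -subr_ge0.
have -> : A ^+ 2 * i%:R ^+ 2 * (1 - 2 * (delta / i%:R)) -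
  (A ^+ 2 * (i%:R + 1) ^+ 2 - 2 * (i%:R + 1) * a + 1) =
  (a - A ^+ 2) * i%:R - (A ^+ 2 - 2 * a + 1).
  by rewrite /delta; field; rewrite !gt_eqF//= -?exprn_gt0.
by rewrite subr_ge0 [leRHS]mulrC -ler_pdivrMr ?subr_gt0.
Qed.

(** With the first unit vector as right-hand side, the means satisfy the
    homogeneous recurrence from index 1 on and never vanish, so their growth
    has order exp (delta H_n), a power of n. In c_0(w_k) they are bounded by
    exp (alpha_n / k), a power of n with an exponent that tends to 0 as k
    increases. *)
Lemma D1_not_surjective (R : realType) (alpha : nat -> R) (l : R[i])
    (x : nat -> R[i]) :
  increasing_to_infty alpha -> S_set alpha 1 !=set0 -> D 1 (l : R[i]^o) ->
  x \in Lambda0 alpha ->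
  l *: x - arithmetic_mean x <> (fun n => (n == 0%N)%:R).
Proof.
move=> ha hS Dl xL lx.
have rec := mean_recurrence_cesaro l x; rewrite lx in rec.
have /(arithmetic_mean_Lambda0 ha) := xL; set m := arithmetic_mean x in rec *.
move=> mL; clearbody m.
have l0 : l != 0.
  move/D_Re_normc : Dl => /(_ ltr01); apply: contraTneq => ->.
  by rewrite normc0 expr0n /= mulr0 ltxx.
have [delta d0 [N hN]] := D1_gap Dl.
have m_neq0 i : m i != 0.
  elim: i => [|i IH]; apply/negP => /eqP mi.
    by have /eqP := rec 0%N; rewrite mi !mulr0 ?mul0r add0r eq_sym oner_eq0.
  have /eqP := rec i.+1; rewrite mi mulr0 /= addr0 eq_sym mulf_eq0 (negbTE IH).
  by rewrite orbF mulf_eq0 (negbTE l0) pnatr_eq0.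
(* Lower bound: the means grow at least like exp (delta H_n). *)
pose H n := series (@harmonic R) n.
have mS i : (N <= i)%N ->
    expR (delta / i.+1%:R) * normc (m i) <= normc (m i.+1).
  move=> Ni; have := rec i.+1; rewrite /= addr0 => /(congr1 (@normc R)).
  rewrite !normcM normc_nat => E.
  have lt0 : 0 < normc l * i.+1%:R by rewrite mulr_gt0// normc_gt0.
  rewrite -(ler_pM2l lt0) mulrCA -E mulrA ler_wpM2r ?normc_ge0//.
  rewrite mulrC -ler_pdivlMr ?expR_gt0// -expRN.
  exact: hN (leqW Ni).
pose c := normc (m N) * expR (- (delta * H N)).
have c_gt0 : 0 < c by rewrite mulr_gt0 ?expR_gt0// normc_gt0.
have lower n : (N <= n)%N -> c * expR (delta * H n) <= normc (m n).
  elim: n => [|n IH].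
    by rewrite leqn0 => /eqP N0; rewrite /c N0 -mulrA -expRD addNr expR0 mulr1.
  rewrite leq_eqVlt => /predU1P[<-|Nn].
    by rewrite /c -mulrA -expRD addNr expR0 mulr1.
  apply: le_trans (mS n Nn).
  have -> : c * expR (delta * H n.+1) =
      expR (delta / n.+1%:R) * (c * expR (delta * H n)).
    by rewrite /H series_harmonicS mulrDr expRD; ring.
  by rewrite ler_wpM2l ?expR_ge0//; exact: IH.
(* Upper bound: for k large, membership in c_0(w_k) limits the growth to half of
   that exponent. *)
have [b [s [b0 s0 hb]]] := alpha_log_growth ha hS.
pose k := (Num.bound (s / (delta / 2))).+1.
have k0 : (0 : R) < k%:R by [].
have ske : s / k%:R <= delta / 2.
  rewrite ler_pdivrMr// mulrC -ler_pdivrMr ?divr_gt0//.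
  have /archi_boundP/ltW/le_trans : 0 <= s / (delta / 2).
    by rewrite !divr_ge0// ltW.
  by apply; rewrite ler_nat.
have upper : exists2 C, 0 < C &
    forall n, normc (m n) <= C * expR (delta / 2 * H n).
  have mc : m \in c0 (weight alpha k) by move/Lambda0P : mL; apply.
  exists ((1 + `|sup_norm (weight alpha k) m|) * expR (b / k%:R)).
    by rewrite mulr_gt0 ?expR_gt0// ltr_pwDl.
  move=> n; have := sup_norm_ub n mc.
  rewrite -ler_pdivlMl ?weight_gt0// /weight -expRN mulNr opprK.
  move=> /le_trans; apply.
  rewrite [leLHS]mulrC -[leRHS]mulrA -expRD; apply: ler_pM; rewrite ?expR_ge0//.
  - apply: le_trans (sup_norm_ub 0 mc).
    by rewrite mulr_ge0 ?normc_ge0// expR_ge0.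
  - by rewrite (le_trans (ler_norm _))// lerDr.
  - rewrite ler_expR.
    have lnH : ln n.+1%:R <= H n.
      by rewrite -ler_expR lnK ?posrE// natS_le_expR_harmonic.
    apply: (@le_trans _ _ (b / k%:R + s / k%:R * ln n.+1%:R)).
      by rewrite mulrAC -mulrDl ler_wpM2r ?invr_ge0// (ltW k0).
    rewrite lerD2l; apply: ler_pM => //; first by rewrite divr_ge0// ltW.
    by rewrite ln_ge0// ler1n.
have [C C0 hC] := upper.
have [P hP] := series_harmonic_unbounded (ln (C / c) / (delta / 2)).
have := le_trans (lower _ (leq_maxl N P)) (hC _).
rewrite leNgt => /negP; apply.
have := hP _ (leq_maxr N P); rewrite -/(H _); set h := H _.
rewrite ltr_pdivrMr ?divr_gt0// -ltr_expR lnK ?posrE ?divr_gt0//.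
rewrite ltr_pdivrMr// => Ch.
have -> : delta * h = h * (delta / 2) + delta / 2 * h by field.
by rewrite expRD mulrA [c * _]mulrC ltr_pM2r ?expR_gt0.
Qed.

Lemma D1_spectrum (R : realType) (alpha : nat -> R)
    (ha : increasing_to_infty alpha) : S_set alpha 1 !=set0 ->
  D 1 `<=` spectrum (cesaro_Lambda0 ha).
Proof.
move=> hS l Dl [S [_ _ KS]].
have e0L : (fun n => (n == 0%N)%:R : R[i]) \in Lambda0 alpha.
  by apply: (@finitely_supported_Lambda0 _ _ _ 1%N) => -[].
have Se0 := congr1 (@Lambda0_val R alpha) (KS (Lambda0Space e0L)).
exact: (D1_not_surjective ha hS Dl (Lambda0_valP (S (Lambda0Space e0L))) Se0).
Qed.

(** * From the spaces c_0(w_k) to their intersection *)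

Lemma c0_weight_subset (R : realType) (w w' : nat -> R) (x : nat -> R[i]) :
  (forall n, 0 <= w n) -> (forall n, w n <= w' n) -> x \in c0 w' -> x \in c0 w.
Proof.
move=> w0 ww /c0P h; apply/c0P; apply: (squeeze_cvgr (f := fun=> 0) _ _ h).
  by apply: nearW => n; rewrite mulr_ge0 ?normc_ge0//= ler_wpM2r ?normc_ge0.
exact: cvg_cst.
Qed.

Lemma weight1_le (R : realType) (alpha : nat -> R) (k n : nat) :
  increasing_to_infty alpha -> (0 < k)%N ->
  weight alpha 1 n <= weight alpha k n.
Proof.
move=> [a1 _ _] k0.
have an0 : 0 <= alpha n by exact: (le_trans ler01 (ltW (a1 n))).
rewrite /weight ler_expR divr1 mulNr lerN2.
by rewrite ler_pdivrMr ?ltr0n// ler_peMr// ler1n.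
Qed.

(** The resolvents on the spaces c_0(w_k) are restrictions of one another, so
    they induce one operator on the intersection. *)
Lemma resolvent_c0_Lambda0 (R : realType) (alpha : nat -> R)
    (ha : increasing_to_infty alpha) (l : R[i]) :
  (forall k, (0 < k)%N -> resolvent_set (cesaro_c0 ha (k := k)) l) ->
  resolvent_set (cesaro_Lambda0 ha) l.
Proof.
move=> hl.
pose T i := @cesaro_c0 R alpha ha i.+1.
pose S i := resolvent (T i) l.
have hS i : is_resolvent (T i) l (S i).
  by apply: is_resolvent_resolvent; exact: hl.
pose inc i := @Lambda0_c0 R alpha i.+1 (ltn0Sn i).
(* All the preimages lie in c_0(w_1), where the equation has only one
   solution. *)
have S0E i x : c0_val (S i (inc i x)) = c0_val (S 0%N (inc 0%N x)).
  have y0 : c0_val (S i (inc i x)) \in c0 (weight alpha 1).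
    apply: (c0_weight_subset _ _ (c0_valP (S i (inc i x)))).
      by move=> n; rewrite ltW// weight_gt0.
    by move=> n; exact: weight1_le.
  have [_ SK _] := hS 0%N; have [_ _ KS] := hS i.
  rewrite -[LHS]/(c0_val (C0Space y0)) -(SK (C0Space y0)).
  congr (c0_val (S 0%N _)).
  apply: val_inj => /=.
  exact: (congr1 (@c0_val R alpha i.+1) (KS (inc i x))).
have SL x : c0_val (S 0%N (inc 0%N x)) \in Lambda0 alpha.
  by apply/Lambda0P => -[//|i] _; rewrite -(S0E i); exact: c0_valP.
pose S' x := Lambda0Space (SL x).
have SK x : S' (l *: x - cesaro_Lambda0 ha x) = x.
  apply: val_inj => /=; have [_ SK _] := hS 0%N.
  rewrite -[RHS]/(c0_val (inc 0%N x)) -(SK (inc 0%N x)).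
  by congr (c0_val (S 0%N _)); exact: val_inj.
have KS x : l *: S' x - cesaro_Lambda0 ha (S' x) = x.
  apply: val_inj; have [_ _ KS] := hS 0%N.
  exact: (congr1 (@c0_val R alpha 1) (KS (inc 0%N x))).
have [linC _] := cesaro_Lambda0_continuous_linear ha.
exists S'; split => //; split; first exact: resolvent_linear SK KS.
move=> x U /(seminorm_nbhsP (Lambda0_entourageE alpha))[s [e [e0 sU]]].
(* The topology is initial for the inclusions into the c_0(w_k), so each
   seminorm is controlled through the resolvent of the corresponding space. *)
have : \forall y \near x, forall i, i \in s ->
    Lambda0_norms i (S' x - S' y) < e.
  elim: s {sU} => [|i s IH].
    apply: filterS (near_seminorm (Lambda0_entourageE alpha) x [::] e0).
    by [].
  have [[_ cS] _ _] := hS i.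
  have near_S := cS (inc i x) _ (near_seminorm (c0_entourageE alpha i.+1)
    (S i (inc i x)) [:: tt] e0).
  have [t [e' [e'0 te']]] :=
    (seminorm_nbhsP (c0_entourageE alpha i.+1) _ _).1 near_S.
  have := near_seminorm (Lambda0_entourageE alpha) x [:: i] e'0.
  apply: filterS2 IH => y IH hy j; rewrite in_cons => /predU1P[->|/IH//].
  have SE : Lambda0_norms i (S' x - S' y) =
      c0_norms tt (S i (inc i x) - S i (inc i y)).
    congr (sup_norm _ _).
    by rewrite -[RHS]/(c0_val (S i (inc i x)) - c0_val (S i (inc i y))) !S0E.
  rewrite SE; apply: (te' (inc i y) _ tt (mem_head _ _)) => u _.
  exact: (hy i (mem_head _ _)).
by apply: filterS => y hy; exact: sU.
Qed.

(** * The spectra *)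

Theorem proposition2p18 (R : realType) (alpha : nat -> R)
    (ha : increasing_to_infty alpha) (hS : S_set alpha 1 !=set0) :
  [/\ D 1 `|` [set 1] =
        (\bigcup_(k in [set k | (0 < k)%N]) D (s0 alpha k)) `|` Sigma,
      (\bigcup_(k in [set k | (0 < k)%N]) D (s0 alpha k)) `|` Sigma `<=`
        spectrum (cesaro_Lambda0 ha),
      spectrum (cesaro_Lambda0 ha) `<=`
        \bigcup_(k in [set k | (0 < k)%N]) spectrum (cesaro_c0 ha (k := k)),
      \bigcup_(k in [set k | (0 < k)%N]) spectrum (cesaro_c0 ha (k := k)) `<=`
        closure (D (1 : R)) &
      spectrum_star (cesaro_Lambda0 ha) = closure (spectrum (cesaro_Lambda0 ha)) /\
      closure (spectrum (cesaro_Lambda0 ha)) = closure (D (1 : R))].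
Proof.
have D1s : D 1 `<=` spectrum (cesaro_Lambda0 ha) by exact: D1_spectrum.
have sc : spectrum (cesaro_Lambda0 ha) `<=`
    \bigcup_(k in [set k | (0 < k)%N]) spectrum (cesaro_c0 ha (k := k)).
  move=> l; apply: contra_notP => nl; apply: resolvent_c0_Lambda0 => k k0.
  by apply: contrapT => nk; apply: nl; exists k.
have cD : \bigcup_(k in [set k | (0 < k)%N]) spectrum (cesaro_c0 ha (k := k)) `<=`
    closure (D (1 : R)).
  move=> l [k _]; apply: contra_notP => /off_disc_of_notin_closure[d d0 dl].
  apply: (@off_disc_resolvent_c0 _ _ _ _ d); apply: dl.
  by apply/ball_normc; rewrite subrr normc0.
have clE : closure (spectrum (cesaro_Lambda0 ha)) = closure (D (1 : R)).
  apply/seteqP; split; last exact: closure_subset.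
  rewrite [X in _ `<=` X](closure_id _).1; last exact: closed_closure.
  by apply: closure_subset; exact: subset_trans cD.
split => //.
- exact: D1_bigcup.
- rewrite -D1_bigcup// => l [/D1s//|->]; exact: one_spectrum.
split => //; apply/seteqP; split=> [l|l cl [d [d0 dr _]]].
  rewrite clE; apply: contra_notP => /off_disc_of_notin_closure[d d0 dl].
  exists d; split => //.
    by move=> mu /dl dmu; exact: off_disc_resolvent_Lambda0 dmu.
  exact: (off_disc_resolvent_equicontinuous ha dl).
have [|mu [smu /dr //]] := cl (ball (l : R[i]^o) d%:C).
by apply: nbhsx_ballx; rewrite ltcR.
Qed.
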